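(* Let $G$ be a connected signed eulerian graph. Then $\Phi(G)=3$ if and only if $G$ can be decomposed into three edge-disjoint eulerian subgraphs, each having an odd number of negative edges, that share a common vertex.
   Context: Graphs are finite and may have loops and multiple edges. A graph is eulerian if it is connected and every vertex has even valency. A signed graph is a graph with a signature $\sigma:E\to\{+1,-1\}$. Orientation: each edge has two half-edges; positive edges have exactly one half-edge pointing toward its end, negative edges have both pointing away or both toward their ends. A $\mathbb{Z}$-flow is $\xi:E\to\mathbb{Z}$ such that at each vertex the sum of values on half-edges directed out minus the sum on half-edges directed in is $0$. A nowhere-zero $k$-flow is a $\mathbb{Z}$-flow with values in $\{\pm1,\dots,\pm(k-1)\}$; the flow number $\Phi(G)$ is the least $k$ for which $G$ has a nowhere-zero $k$-flow. *)

(* Defs.v *)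
From HB Require Import structures.
From mathcomp Require Import all_boot all_order all_algebra.

Set Implicit Arguments.
Unset Strict Implicit.
Unset Printing Implicit Defensive.

Import GRing.Theory Num.Theory.
Local Open Scope ring_scope.

(* Every edge [e] has the two half-edges [(e, false)] and [(e, true)], and
   [hend e b] is the vertex to which the half-edge [(e, b)] is attached.  Loops
   ([hend e false = hend e true]) and multiple edges are allowed.
   [negative e] encodes [sigma(e) = -1]. *)
Record sgraph := SGraph {
  vertex : finType;
  edge : finType;
  hend : edge -> bool -> vertex;
  negative : edge -> bool
}.

Record subgraph (G : sgraph) := Subgraph {
  sverts : {set vertex G};
  sedges : {set edge G};
  sendsP : forall (e : edge G) (b : bool), e \in sedges -> hend e b \in sverts
}.

Definition whole (G : sgraph) : subgraph G :=
  @Subgraph G [set: vertex G] [set: edge G] (fun _ _ _ => in_setT _).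

Section Subgraphs.
Variables (G : sgraph) (H : subgraph G).

Definition adj : rel (vertex G) := fun x y =>
  [exists e in sedges H, exists b, (hend e b == x) && (hend e (~~ b) == y)].

Definition connected : Prop :=
  sverts H != set0 /\
  {in sverts H &, forall x y, connect adj x y}.

(* Half-edges are counted, so that a loop contributes 2. *)
Definition valency (v : vertex G) : nat :=
  #|[set h : edge G * bool | (h.1 \in sedges H) && (hend h.1 h.2 == v)]|.

Definition eulerian : Prop :=
  connected /\ {in sverts H, forall v, ~~ odd (valency v)}.

Definition num_negative : nat := #|[set e in sedges H | negative e]|.

End Subgraphs.

Definition decomposition (G : sgraph) (n : nat) (H : 'I_n -> subgraph G) : Prop :=
  [/\ forall i j : 'I_n, i != j -> [disjoint sedges (H i) & sedges (H j)],
      \bigcup_(i < n) sedges (H i) = [set: edge G]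
    & \bigcup_(i < n) sverts (H i) = [set: vertex G]].

Section Flows.
Variable G : sgraph.

(* [out e b] means that the half-edge [(e, b)] points away from [hend e b]. *)
Definition orientation (out : edge G -> bool -> bool) : Prop :=
  forall e, if negative e then out e false = out e true
            else out e false = ~~ out e true.

Definition is_flow (out : edge G -> bool -> bool) (xi : edge G -> int) : Prop :=
  forall v : vertex G,
    \sum_(h : edge G * bool | (hend h.1 h.2 == v) && out h.1 h.2) xi h.1
    - \sum_(h : edge G * bool | (hend h.1 h.2 == v) && ~~ out h.1 h.2) xi h.1
    = 0.

(* Reversing an edge and negating its value preserves flows, so the choice of
   the orientation is immaterial. *)
Definition has_nowhere_zero_flow (k : nat) : Prop :=
  exists out : edge G -> bool -> bool, exists xi : edge G -> int,
    [/\ orientation out, is_flow out xi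
      & forall e, (0 < `|xi e| < k)%N].

(* A relation, because a signed graph need not have a nowhere-zero flow. *)
Definition flow_number (k : nat) : Prop :=
  has_nowhere_zero_flow k /\
  forall j : nat, has_nowhere_zero_flow j -> (k <= j)%N.

End Flows.

(* Main.v *)
Require Import Defs.
From HB Require Import structures.
From mathcomp Require Import all_boot all_order all_algebra.
From mathcomp Require Import boolp zify.

Set Implicit Arguments.
Unset Strict Implicit.
Unset Printing Implicit Defensive.

Import GRing.Theory.

(** Following an Euler tour and flipping the sign at every negative edge yields
    values +1, -1 that balance everywhere except at the start, where the net
    outflow is 0 or 2 according to the parity of the number of negative edges.
    So an even graph has a 2-flow, an odd one does not, and three odd closed
    trails through one vertex, weighted 1, 1 and -2, give a 3-flow.

    Conversely let an odd eulerian graph carry a 3-flow.  A side of a 2-edge-cut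
    can be replaced by one edge, whose sign is dictated by the flow, and a
    balanced side of a 4-edge-cut by two edges; in both cases closed trails of
    the smaller graph expand to the larger one.  When no such cut is left, take a
    minimal vertex set [Y] with at most four boundary edges: then at least six
    edges leave every set that separates [Y].  Contract [Y] to a hub.  A negative
    edge inside [Y] is an odd closed trail at the hub and the remainder of the
    tour an even one; if the latter could not be rerouted into two odd closed
    trails, a switching would leave a single negative edge, which a flow forbids.
    Vertices are now removed from the hub one by one, always keeping two odd
    closed trails at the hub.  When the hub is a single vertex, everything else
    is the third odd closed trail. *)

(** Connected even graphs are handled as closed walks, so cutting, rerouting and replacing a side of
    a cut are operations on lists of oriented edges, compared up to order and orientation by [eqd].
    Cuts of a closed walk are even; this is why excluding 2 leaves 4, and beating 4 gives 6.

    The obstacle is parity: every rerouting must keep enough odd walks. Two walks that meet can be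
    recombined in two new ways, and one of them never loses an odd walk, so Menger-type augmentation
    goes through. Six edges suffice at a removed vertex because each of the two odd walks uses at
    most two walks to it, and one further pair carries whatever is left.

    The flow enters only through sums weighted by a function [g] on the vertices: [g = 1] gives
    parities, [g = (-1) ^+ s] expresses a switching, and [g] vanishing on [Z] restricts conservation
    to the other side of a cut. The bound 3 enters twice: nonzero values of equal parity agree up to
    sign, and four values with sum 0 split into two cancelling pairs. *)

Lemma prefix_cases (T : Type) (p1 p2 q1 q2 : seq T) : p1 ++ p2 = q1 ++ q2 ->
  (exists r, q1 = p1 ++ r /\ p2 = r ++ q2) \/ (exists r, p1 = q1 ++ r /\ q2 = r ++ p2).
Proof.
elim: p1 q1 => [|x1 p1 IH] [|y1 q1] /= E.
- by left; exists [::].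
- by left; exists (y1 :: q1).
- by right; exists (x1 :: p1).
by case: E => -> /IH[[r [-> ->]]|[r [-> ->]]]; [left|right]; exists r.
Qed.

Lemma split_first (T : Type) (P : pred T) p : 0 < count P p -> exists p1 d p2,
  [/\ p = p1 ++ d :: p2, count P p1 = 0, P d & count P p = (count P p2).+1].
Proof.
elim: p => //= d p IH; case Pd: (P d) => /=; first by exists [::], d, p.
case/IH=> p1 [c [p2 [-> n1 Pc E]]]; exists (d :: p1), c, p2.
by split=> //=; rewrite ?Pd.
Qed.

(** * Walks *)

Section Walks.
(* [D] is a type of oriented edges; [rv] reverses them.  A graph is a list
   containing each edge in one of its two orientations. *)
Variables (V : finType) (D : eqType) (src : D -> V) (rv : D -> D).
Hypothesis rvK : involutive rv.

Definition tgt d := src (rv d).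

Fixpoint walk a p b :=
  if p is d :: p' then (src d == a) && walk (tgt d) p' b else a == b.

Definition verts a p := a :: map tgt p.
Definition rw p := rev (map rv p).
(** A dart fixed by [rv], such as a negative loop among the [fdart]s, is counted twice; since this
    happens on both sides, [eqd] is not affected. *)
Definition cnt d p := count_mem d p + count_mem (rv d) p.
Arguments cnt : simpl never.
(* The same edges with the same multiplicities, up to orientation. *)
Definition eqd p q := forall d, cnt d p = cnt d q.
Definition cross (Z : {set V}) d := (src d \in Z) != (tgt d \in Z).

Lemma tgt_rv d : tgt (rv d) = src d.
Proof. by rewrite /tgt rvK. Qed.

Lemma walk_cat a p c q b : walk a p c -> walk c q b -> walk a (p ++ q) b.
Proof. by elim: p a => [a /eqP-> //|d p IH a /= /andP[-> ?] ?]; apply: IH. Qed.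

Lemma walk_catE a p q b :
  walk a (p ++ q) b -> exists2 c, walk a p c & walk c q b.
Proof.
elim: p a => [a w|d p IH a /= /andP[-> /IH[c ? ?]]]; last by exists c.
by exists a => /=.
Qed.

Lemma walk_fun a p b c : walk a p b -> walk a p c -> b = c.
Proof. by elim: p a => [a /eqP<- /eqP|d p IH a /= /andP[_ /IH h] /andP[_ /h]]. Qed.

Lemma walk_suffix a p c q b : walk a p c -> walk a (p ++ q) b -> walk c q b.
Proof. by move=> w /walk_catE[d /(walk_fun w)->]. Qed.

Lemma walk_start_fun a c p b : walk a p b -> walk c p b -> a = c.
Proof. by case: p => [/eqP-> /eqP->|d p /andP[/eqP<- _] /andP[/eqP<- _]]. Qed.

Lemma walk1 d : walk (src d) [:: d] (tgt d).
Proof. by rewrite /= !eqxx. Qed.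

Lemma walk_start a d p b : walk a (d :: p) b -> a = src d.
Proof. by case/andP=> /eqP. Qed.

Lemma vertsP a p b y : walk a p b -> y \in verts a p ->
  exists p1 p2, [/\ p = p1 ++ p2, walk a p1 y & walk y p2 b].
Proof.
elim: p a => [|d p IH] a /= w.
  by rewrite inE => /eqP->; exists [::], [::]; split=> //=.
rewrite inE => /predU1P[->|yV]; first by exists [::], (d :: p); split=> //=.
case/andP: w => sd /IH/(_ yV)[p1 [p2 [-> w1 w2]]].
by exists (d :: p1), p2; split; rewrite //= sd.
Qed.

Lemma verts_end a p b : walk a p b -> b \in verts a p.
Proof.
elim: p a => [a /eqP->|d p IH a /andP[_ /IH]]; first by rewrite inE.
by rewrite /= !inE => ->; rewrite orbT.
Qed.

Lemma verts_cat a p b q y : walk a p b ->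
  (y \in verts a (p ++ q)) = (y \in verts a p) || (y \in verts b q).
Proof.
move=> w; rewrite !inE /verts map_cat mem_cat.
case: (y \in map tgt q); rewrite ?orbT ?orbF //.
have [->|_] := eqVneq y b; last by rewrite !orbF.
by have := verts_end w; rewrite inE !orbT => ->.
Qed.

Lemma rw_cat p q : rw (p ++ q) = rw q ++ rw p.
Proof. by rewrite /rw map_cat rev_cat. Qed.

Lemma rw_cons d p : rw (d :: p) = rw p ++ [:: rv d].
Proof. by rewrite /rw /= rev_cons cats1. Qed.

Lemma rwK : involutive rw.
Proof. by move=> p; rewrite /rw map_rev revK mapK. Qed.

Lemma walk_rw a p b : walk a p b -> walk b (rw p) a.
Proof.
elim: p a => [a /eqP->|d p IH a /= /andP[/eqP<- /IH w]]; first exact: eqxx.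
by rewrite rw_cons; apply: walk_cat w _; rewrite /= tgt_rv !eqxx.
Qed.

Lemma verts_rw a p b : walk a p b -> verts b (rw p) =i verts a p.
Proof.
move=> w y; apply/idP/idP.
  case/(vertsP (walk_rw w))=> p1 [p2 [e w1 w2]].
  have {e}e : p = rw p2 ++ rw p1 by rewrite -rw_cat -e rwK.
  by rewrite e (verts_cat _ _ (walk_rw w2)) verts_end ?walk_rw.
case/(vertsP w)=> p1 [p2 [e w1 w2]].
by rewrite e rw_cat (verts_cat _ _ (walk_rw w2)) verts_end ?walk_rw.
Qed.

Lemma cnt_cat d p q : cnt d (p ++ q) = cnt d p + cnt d q.
Proof. by rewrite /cnt !count_cat; lia. Qed.

Lemma cnt_cons d x p : cnt d (x :: p) = cnt d [:: x] + cnt d p.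
Proof. by rewrite -cat1s cnt_cat. Qed.

Lemma cnt_nil d : cnt d [::] = 0.
Proof. by []. Qed.

Lemma cnt_rv d x : cnt d [:: rv x] = cnt d [:: x].
Proof.
by rewrite /cnt /= (can2_eq rvK rvK) [rv x == rv d](inj_eq (can_inj rvK)); lia.
Qed.

Lemma cnt_rw d p : cnt d (rw p) = cnt d p.
Proof. by elim: p => // x p IH; rewrite rw_cons cnt_cat IH cnt_rv [RHS]cnt_cons addnC. Qed.

Lemma cnt_perm d p q : perm_eq p q -> cnt d p = cnt d q.
Proof. by move/permP=> h; rewrite /cnt !h. Qed.

Lemma cnt_flatten_perm d s t : perm_eq s t -> cnt d (flatten s) = cnt d (flatten t).
Proof.
have E u : cnt d (flatten u) = \sum_(p <- u) cnt d p.
  by elim: u => [|p u IH]; rewrite ?big_nil // big_cons cnt_cat IH.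
by move=> h; rewrite !E (perm_big _ h).
Qed.

Lemma eqd_sym p q : eqd p q -> eqd q p. Proof. by move=> h d. Qed.
Lemma eqd_trans p q r : eqd p q -> eqd q r -> eqd p r.
Proof. by move=> h k d; rewrite h. Qed.

(** Appending all reversals turns [eqd] into [perm_eq] and doubles the count of a predicate
    invariant under reversal. *)
Lemma eqd_count (P : pred D) p q :
  (forall d, P (rv d) = P d) -> eqd p q -> count P p = count P q.
Proof.
move=> Prv h.
have cd u : count P (u ++ map rv u) = (count P u).*2.
  by rewrite count_cat count_map -addnn; congr addn; apply: eq_count => d /=.
have cm u d : count_mem d (u ++ map rv u) = cnt d u.
  rewrite count_cat count_map; congr addn; apply: eq_count => x /=.
  by rewrite (can2_eq rvK rvK).
have /permP/(_ P) : perm_eq (p ++ map rv p) (q ++ map rv q).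
  by apply/allP => d _ /=; rewrite !cm h.
by rewrite !cd => /double_inj.
Qed.

Lemma eqd_size p q : eqd p q -> size p = size q.
Proof. by move=> h; rewrite -!count_predT; apply: eqd_count. Qed.

Lemma eqd_mem p q d : eqd p q -> d \in p -> (d \in q) || (rv d \in q).
Proof.
move=> /(_ d) h; rewrite -!has_pred1 !has_count => dp.
by move: h; rewrite /cnt; lia.
Qed.

Lemma cross_rv Z d : cross Z (rv d) = cross Z d.
Proof. by rewrite /cross tgt_rv eq_sym. Qed.

Lemma odd_cross Z a p b : walk a p b ->
  odd (count (cross Z) p) = (a \in Z) (+) (b \in Z).
Proof.
elim: p a => [a /eqP->|d p IH a /= /andP[/eqP<- /IH]]; first by rewrite addbb.
by rewrite oddD /cross => ->; do 3?[case: (_ \in Z)].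
Qed.

Lemma cross_const (Z : {set V}) a p b c : walk a p b ->
  {in verts a p, forall y, (y \in Z) = c} -> count (cross Z) p = 0.
Proof.
elim: p a => [//|d p IH] a /= /andP[/eqP sd w] h.
rewrite (IH _ w); last by move=> y yp; apply: h; rewrite inE yp orbT.
by rewrite /cross sd !h ?eqxx //= !inE eqxx ?orbT.
Qed.

Lemma walk_cross0 (Z : {set V}) a p b : walk a p b -> count (cross Z) p = 0 ->
  {in verts a p, forall y, (y \in Z) = (a \in Z)}.
Proof.
elim: p a => [|d p IH] a /=; first by move=> _ _ y; rewrite inE => /eqP->.
case/andP=> /eqP sd wp; case: (boolP (cross Z d)) => //; rewrite /cross negbK sd => /eqP dZ c0.
move=> y; rewrite inE => /predU1P[->//|yp].
by rewrite (IH _ wp c0) // dZ.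
Qed.

Lemma dart_verts a w b d : walk a w b -> d \in w ->
  src d \in verts a w /\ tgt d \in verts a w.
Proof.
move=> cw dw; case/splitPr: dw cw => p1 p2 /walk_catE[c w1 /andP[/eqP sd w2]].
have w3 : walk a (p1 ++ [:: d]) (tgt d) by apply: walk_cat w1 _; rewrite /= sd !eqxx.
split; first by rewrite (verts_cat _ _ w1) sd verts_end.
by rewrite -cat1s catA (verts_cat _ _ w3) verts_end.
Qed.

Lemma rotate_closed v w d : walk v w v -> d \in w ->
  exists2 p, walk (tgt d) p (src d) & perm_eq w (d :: p).
Proof.
move=> cw dw; case/splitPr: dw cw => w1 w2 /walk_catE[c k1 /andP[/eqP-> k2]].
exists (w2 ++ w1); first exact: walk_cat k2 k1.
by rewrite perm_catC perm_cons.
Qed.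

Lemma walk_exit (Z : {set V}) k a p b : walk a p b -> a \in Z ->
  count (cross Z) p = k.+1 -> exists P c O, [/\ p = P ++ c :: O,
    walk a P (src c) /\ walk (tgt c) O b, {in verts a P, forall y, y \in Z},
    tgt c \notin Z & count (cross Z) O = k].
Proof.
move=> w aZ E; have [|P [c [O [Ep P0 cc EO]]]] := @split_first _ (cross Z) p.
  by rewrite E.
move: w; rewrite Ep => /walk_catE[u wP /andP[/eqP sc wO]]; subst u.
have PZ : {in verts a P, forall y, y \in Z}.
  by move=> y yP; rewrite (walk_cross0 wP P0 yP).
exists P, c, O; split=> //; last by move: EO; rewrite E => -[].
by move: cc; rewrite /cross (PZ _ (verts_end wP)); case: (_ \in _).
Qed.

Lemma closed_enter (Z : {set V}) v w : walk v w v -> 0 < count (cross Z) w ->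
  exists c p, [/\ walk (tgt c) p (src c), src c \notin Z, tgt c \in Z &
    perm_eq w (c :: p)].
Proof.
move=> cw; rewrite -has_count => /hasP[d dw cd].
have [p wp pp] := rotate_closed cw dw.
have [sZ|sZ] := boolP (src d \in Z); last first.
  by exists d, p; split=> //; move: cd; rewrite /cross (negbTE sZ) negbK.
have tZ : tgt d \in ~: Z by move: cd; rewrite /cross sZ in_setC; case: (_ \in _).
have cC x : cross (~: Z) x = cross Z x by rewrite /cross !in_setC; do 2!case: (_ \in _).
(* The dart found leaves [Z], so the rest of the tour returns to [Z] from outside; its first exit
   from the complement is the dart sought. *)
have : odd (count (cross (~: Z)) p) by rewrite (odd_cross _ wp) tZ in_setC sZ.
case E: (count _ p) => [|k] // _.
have [P [c [O [Ep [wP wO] PZ tc _]]]] := walk_exit wp tZ E.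
exists c, (O ++ d :: P); split.
- by apply: walk_cat wO _; rewrite /= eqxx.
- by have := PZ _ (verts_end wP); rewrite in_setC.
- by move: tc; rewrite in_setC negbK.
apply: perm_trans pp _; rewrite Ep -[d :: P ++ _]cat_cons perm_catC.
by rewrite cat_cons.
Qed.

End Walks.

Ltac eqd_solve :=
  let d := fresh "d" in intro d; cbn [fst snd];
  repeat match goal with H : eqd _ _ _ |- _ => move: (H d); clear H end;
  repeat match goal with
    | |- context [cnt ?r d (?x :: ?p)] =>
        lazymatch p with nil => fail | _ => rewrite (cnt_cons r d x p) end
    | |- context [cnt ?r d (?p ++ ?q)] => rewrite (cnt_cat r d p q)
    | K : involutive ?r |- context [cnt ?r d (rw ?r ?p)] => rewrite (cnt_rw K d p)
    | K : involutive ?r |- context [cnt ?r d [:: ?r ?p]] => rewrite (cnt_rv K d p)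
  end;
  rewrite ?cnt_nil;
  repeat match goal with |- context [cnt ?r d ?p] => generalize (cnt r d p) end;
  clear; lia.

(** * Balanced families of walks *)

Section Parity.
Variables (V : finType) (D : eqType) (src : D -> V) (rv : D -> D).
Hypothesis rvK : involutive rv.
Variable par : D -> bool.
Hypothesis par_rv : forall d, par (rv d) = par d.

Notation tgt := (tgt src rv).
Notation walk := (walk src rv).
Notation verts := (verts src rv).
Notation rw := (rw rv).
Notation eqd := (eqd rv).
Notation cross := (cross src rv).

Definition pr p := odd (count par p).

Lemma pr_cat p q : pr (p ++ q) = pr p (+) pr q.
Proof. by rewrite /pr count_cat oddD. Qed.

Lemma pr_cons d p : pr (d :: p) = par d (+) pr p.
Proof. by rewrite /pr /= oddD; case: par. Qed.

Lemma pr_rw p : pr (rw p) = pr p.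
Proof.
rewrite /pr /rw count_rev count_map; congr odd.
by apply: eq_count => d /=.
Qed.

Lemma pr_eqd p q : eqd p q -> pr p = pr q.
Proof. by move=> h; rewrite /pr (eqd_count rvK par_rv h). Qed.

(* Every vertex on [M] can be reached with either parity by rerouting [M]. *)
Definition flex z M z' := forall u, u \in verts z M -> forall e : bool,
  exists M1 M2, [/\ walk z M1 u, walk u M2 z', eqd (M1 ++ M2) M & pr M1 = e].

Lemma flex_rev z M z' : walk z M z' -> flex z M z' -> flex z' (rw M) z.
Proof.
move=> w f u; rewrite (verts_rw rvK w) => /f fu e.
have [M1 [M2 [w1 w2 E pM]]] := fu (e (+) pr M).
exists (rw M2), (rw M1); split; rewrite ?walk_rw //; first by eqd_solve.
by rewrite pr_rw -[pr M2](addKb (pr M1)) -pr_cat (pr_eqd E) pM addbK.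
Qed.

(** Going around the closed walk in the other direction reaches [u] with the opposite parity. *)
Lemma flex_odd_closed z M : walk z M z -> pr M -> flex z M z.
Proof.
move=> w oM u /(vertsP w)[M1 [M2 [E w1 w2]]] e.
have [<-|ne] := eqVneq (pr M1) e; first by exists M1, M2; split=> //; rewrite E.
exists (rw M2), (rw M1); split; rewrite ?walk_rw //; first by rewrite E; eqd_solve.
by move: oM ne; rewrite E pr_cat pr_rw; case: e; case: (pr M1); case: (pr M2).
Qed.

(** A vertex [y] on [P] can be reached along [P], or by going from [u] through part of [M] back to
    [z] and then along [P] reversed. Flexibility of [M] sets the parity of that part so that the two
    routes to [y] differ in parity. *)
Lemma flex_grow u P z M z' : walk u P z -> walk z M z' -> u \in verts z M ->
  flex z M z' -> flex u (P ++ M) z'.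
Proof.
move=> wP wM uM f y; rewrite (verts_cat _ _ wP) => /orP[yP|yM] e; last first.
  have [M1 [M2 [w1 w2 E pM]]] := f y yM (e (+) pr P).
  exists (P ++ M1), M2; split=> //; [exact: walk_cat wP w1|by eqd_solve|].
  by rewrite pr_cat pM addbC addbK.
have [P1 [P2 [EP w1 w2]]] := vertsP wP yP.
have [pe|ne] := eqVneq (pr P1) e.
  exists P1, (P2 ++ M); split=> //; first exact: walk_cat w2 wM.
  by rewrite EP; eqd_solve.
have [M1 [M2 [v1 v2 E pM]]] := f u uM (~~ pr P).
exists (rw M1 ++ rw P2), (rw P1 ++ M2); split.
- by apply: walk_cat (walk_rw rvK v1) (walk_rw rvK w2).
- by apply: walk_cat v2; apply: walk_rw.
- by rewrite EP; eqd_solve.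
by move: ne; rewrite pr_cat !pr_rw pM EP pr_cat; clear; case: e; case: (pr P1); case: (pr P2).
Qed.


Definition item : Type := (V * V * seq D)%type.
Definition itrail (i : item) := walk i.1.1 i.2 i.1.2.
Definition flat (Q : seq item) := flatten (map snd Q).
Lemma flat_cons i Q : flat (i :: Q) = i.2 ++ flat Q. Proof. by []. Qed.
Lemma flat_cat Q1 Q2 : flat (Q1 ++ Q2) = flat Q1 ++ flat Q2.
Proof. by rewrite /flat map_cat flatten_cat. Qed.
Definition hubbed (H : {set V}) (Q : seq item) :=
  forall i, i \in Q -> [/\ itrail i, i.1.1 \in H & i.1.2 \in H].

(* An item [(a, b, p)] is a walk [p] from [a] to [b], closed once the vertices
   of the hub [H] are identified. *)
Definition splittable (H : {set V}) Q := exists i Q0 c p1 p2,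
  [/\ perm_eq Q (i :: Q0), c \in H, walk i.1.1 p1 c /\ walk c p2 i.1.2,
      eqd (p1 ++ p2) i.2 & pr p1 /\ pr p2].

Definition swappable (Q : seq item) := exists i j Q0 p q,
  [/\ perm_eq Q (i :: j :: Q0), walk i.1.1 p j.1.2, walk j.1.1 q i.1.2,
      eqd (p ++ q) (i.2 ++ j.2) & pr p /\ pr q].

Definition two_cut (H : {set V}) Q := exists Z : {set V},
  [/\ [disjoint Z & H], Z != set0 & count (cross Z) (flat Q) = 2].

Lemma cross_last (Z : {set V}) a P z : walk a P z -> z \in Z -> a \notin Z ->
  (forall P1 P2 y, P = P1 ++ P2 -> walk a P1 y -> P2 != [::] -> y \notin Z) ->
  count (cross Z) P = 1.
Proof.
case: (lastP P) => [/eqP<- -> //|{}P d w zZ aZ h].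
have [y wP wd] : exists2 y, walk a P y & walk y [:: d] z.
  by apply: walk_catE; rewrite cats1.
rewrite -cats1 count_cat (cross_const (c := false) wP) /=; last first.
  move=> u /(vertsP wP)[P1 [P2 [E w1 _]]]; apply/negbTE.
  by apply: h w1 _; [rewrite E rcons_cat; reflexivity|case: (P2)].
have yZ : y \notin Z by apply: h wP _; [rewrite -cats1; reflexivity|].
by case/andP: wd => /eqP sd /eqP td; rewrite /cross sd td zZ (negbTE yZ).
Qed.

Lemma cross_first (Z : {set V}) a P z : walk z P a -> z \in Z -> a \notin Z ->
  (forall P1 P2 y, P = P1 ++ P2 -> walk z P1 y -> P1 != [::] -> y \notin Z) ->
  count (cross Z) P = 1.
Proof.
case: P => [/eqP<- -> //|d P /= /andP[/eqP sd w] zZ aZ h].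
rewrite (cross_const (c := false) w) /=; last first.
  move=> u /(vertsP w)[P1 [P2 [E w1 _]]]; apply/negbTE.
  by apply: (h (d :: P1) P2); rewrite //= ?E // sd eqxx.
have yZ : tgt d \notin Z by apply: (h [:: d] P); rewrite //= sd !eqxx.
by rewrite /cross sd zZ (negbTE yZ).
Qed.

Section Flexible.
Variables (H : {set V}) (Q0 : seq item) (a b : V) (p : seq D).
Let Q := (a, b, p) :: Q0.
Hypotheses (hQ : hubbed H Q) (eQ : forall i, i \in Q -> ~~ pr i.2).

(* A maximal flexible segment meets neither the hub, nor another item, nor the
   rest of its own item, unless rerouting yields odd items; hence its vertex set
   is left by two edges only. *)
Lemma flex_outcome n z z' P M R : size P + size R < n ->
  p = P ++ M ++ R -> walk a P z -> walk z M z' -> walk z' R b ->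
  flex z M z' -> [\/ splittable H Q, swappable Q | two_cut H Q].
Proof.
elim: n z z' P M R => // n IH z z' P M R sn Ep wP wM wR fM.
have [w_p aH bH] : [/\ walk a p b, a \in H & b \in H] by apply: (hQ (mem_head _ _)).
have ep : ~~ pr p by apply: (eQ (mem_head _ _)).
have [/exists_inP[u uM uH]|noH] := boolP [exists u in verts z M, u \in H].
  (* The parity of [M1] makes the first half odd; as [p] is even, the second half is odd too. *)
  apply: Or31; have [M1 [M2 [w1 w2 E pM]]] := fM u uM (~~ pr P).
  exists (a, b, p), Q0, u, (P ++ M1), (M2 ++ R); split=> //.
  - by split; [exact: walk_cat wP w1|exact: walk_cat w2 wR].
  - by rewrite Ep; eqd_solve.
  have := pr_eqd E; move: ep; rewrite Ep !pr_cat pM; clear.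
  by case: (pr P); case: (pr M); case: (pr M2); case: (pr R).
have [[j [u [jQ uM uj]]]|noj] := pselect (exists j u,
    [/\ j \in Q0, u \in verts z M & u \in verts j.1.1 j.2]).
  apply: Or32; have [w_j jH jH'] : [/\ itrail j, j.1.1 \in H & j.1.2 \in H].
    by apply: hQ; rewrite inE jQ orbT.
  have ej : ~~ pr j.2 by apply: eQ; rewrite inE jQ orbT.
  have [q1 [q2 [Ej v1 v2]]] := vertsP w_j uj.
  (* The two items exchange tails at [u]; the parity of [M1] is the one that makes the first new
     item odd, and evenness of [p] and [j.2] gives the other. *)
  have [M1 [M2 [w1 w2 E pM]]] := fM u uM (pr P (+) ~~ pr q1).
  exists (a, b, p), j, (rem j Q0), (P ++ M1 ++ q2), (q1 ++ M2 ++ R).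
  split=> /=; first by rewrite perm_cons perm_to_rem.
  - by apply: walk_cat wP _; apply: walk_cat w1 v2.
  - by apply: walk_cat v1 _; apply: walk_cat w2 wR.
  - by rewrite Ep Ej; eqd_solve.
  have := pr_eqd E; move: ep ej; rewrite Ep Ej !pr_cat pM; clear.
  by case: (pr P); case: (pr M); case: (pr M2); case: (pr R); case: (pr q1); case: (pr q2).
(* If [P] meets [M] before its end, the stretch [P2] from there on is absorbed into the flexible
   segment, which shortens [P]. *)
have [[P1 [P2 [u [EP w1 nP uM]]]]|noP] := pselect (exists P1 P2 u,
    [/\ P = P1 ++ P2, walk a P1 u, P2 != [::] & u \in verts z M]).
  have w2 : walk u P2 z by apply: (walk_suffix w1); rewrite -EP.
  apply: (IH u z' P1 (P2 ++ M) R); rewrite ?Ep ?EP ?catA //.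
  - by move: sn nP; rewrite EP !size_cat -size_eq0; clear; lia.
  - exact: walk_cat w2 wM.
  exact: flex_grow w2 wM uM fM.
have [[R1 [R2 [u [ER w1 nR uM]]]]|noR] := pselect (exists R1 R2 u,
    [/\ R = R1 ++ R2, walk z' R1 u, R1 != [::] & u \in verts z M]).
  have w2 : walk u R2 b by apply: (walk_suffix w1); rewrite -ER.
  apply: (IH z u P (M ++ R1) R2); rewrite ?Ep ?ER ?catA //.
  - by move: sn nR; rewrite ER !size_cat -size_eq0; clear; lia.
  - exact: walk_cat wM w1.
  rewrite -[M ++ R1](rwK rvK) rw_cat; apply: flex_rev => //.
    by apply: walk_cat (walk_rw rvK wM); apply: walk_rw.
  apply: flex_grow (flex_rev wM fM); rewrite ?walk_rw //.
  by rewrite (verts_rw rvK wM).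
apply: Or33; exists [set u in verts z M].
have zM : z \in verts z M by rewrite inE eqxx.
have nHM u : u \in H -> u \notin verts z M.
  by move=> uH; apply: contra noH => uM; apply/exists_inP; exists u.
split.
- rewrite disjoint_sym; apply/pred0P => u /=; rewrite inE.
  by apply/negbTE/negP => /andP[/nHM/negP].
- by apply/set0Pn; exists z; rewrite inE.
rewrite /flat /= Ep -!catA !count_cat.
rewrite (cross_const (c := true) wM); last by move=> u; rewrite inE.
rewrite (cross_last wP) ?in_set ?nHM //; first last.
- move=> P1 P2 y EP w1 nP; rewrite inE; apply/negP => yM.
  by apply: noP; exists P1, P2, y.
have z'M : z' \in [set u in verts z M] by rewrite in_set; exact: verts_end wM.
rewrite (cross_first wR z'M) ?in_set ?nHM //; first last.
- move=> R1 R2 y ER w1 nR; rewrite inE; apply/negP => yM.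
  by apply: noR; exists R1, R2, y.
rewrite (_ : count _ _ = 0) // count_flatten sumnE big_map big_seq big1 // => q.
case/mapP=> j jQ ->; have [w_j _ _] : [/\ itrail j, j.1.1 \in H & j.1.2 \in H].
  by apply: hQ; rewrite inE jQ orbT.
apply: (cross_const (c := false) w_j) => u uj; rewrite inE; apply/negbTE/negP => uM.
by apply: noj; exists j, u.
Qed.

End Flexible.

Lemma hubbed_perm H Q Q' : perm_eq Q Q' -> hubbed H Q -> hubbed H Q'.
Proof. by move=> h hQ i; rewrite -(perm_mem h); apply: hQ. Qed.

(** Let [tau] record the parity with which a vertex is reached along its item. A vertex reached with
    both parities by different items allows an exchange of tails; on a single item it closes an odd
    subwalk, which is flexible. A hub vertex reached oddly splits its item. Otherwise [tau] is well
    defined, and it changes along an edge exactly when the edge is odd. *)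
Lemma balanced_or_improvable H Q : hubbed H Q -> (forall i, i \in Q -> ~~ pr i.2) ->
  [\/ splittable H Q, swappable Q, two_cut H Q |
   exists2 tau : V -> bool, forall h, h \in H -> tau h = false &
     forall d, d \in flat Q -> par d = tau (src d) (+) tau (tgt d)].
Proof.
move=> hQ eQ.
have [s|nsplit] := pselect (splittable H Q); first exact: Or41.
have [s|nswap] := pselect (swappable Q); first exact: Or42.
have [s|ncut] := pselect (two_cut H Q); first exact: Or43.
apply: Or44.
pose reached c y := exists i p1 p2,
  [/\ i \in Q, i.2 = p1 ++ p2, walk i.1.1 p1 y & pr p1 = c].
have no_odd_loop i P M R y : i \in Q -> i.2 = P ++ M ++ R -> walk i.1.1 P y ->
    walk y M y -> pr M -> False.
  case: i => [[a b] p] /= iQ Ep wP wM oM.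
  have pQ := perm_to_rem iQ.
  have hQ' := hubbed_perm pQ hQ; have [w_p _ _] := hQ' _ (mem_head _ _).
  have wR : walk y R b.
    by apply: (walk_suffix wM); apply: (walk_suffix wP); rewrite -Ep.
  have eQ' j : j \in (a, b, p) :: rem (a, b, p) Q -> ~~ pr j.2.
    by rewrite -(perm_mem pQ); apply: eQ.
  case: (flex_outcome hQ' eQ' (ltnSn _) Ep wP wM wR (flex_odd_closed wM oM)).
  - move=> [i [Q0 [c [p1 [p2 [h h1 h2 h3 h4]]]]]]; apply: nsplit.
    by exists i, Q0, c, p1, p2; split=> //; apply: perm_trans h.
  - move=> [i [j [Q0 [p1 [p2 [h h1 h2 h3 h4]]]]]]; apply: nswap.
    by exists i, j, Q0, p1, p2; split=> //; apply: perm_trans h.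
  - move=> [Z [dZ nZ cZ]]; apply: ncut; exists Z; split=> //; rewrite -cZ.
    by apply/permP; apply: perm_flatten; apply: perm_map.
have consistent y : reached true y -> reached false y -> False.
  move=> [i [p1 [p2 [iQ Ei w1 o1]]]] [j [q1 [q2 [jQ Ej v1 e1]]]].
  have [it ia ib] := hQ i iQ; have [jt ja jb] := hQ j jQ.
  have w2 : walk y p2 i.1.2 by apply: (walk_suffix w1); rewrite -Ei.
  have v2 : walk y q2 j.1.2 by apply: (walk_suffix v1); rewrite -Ej.
  have [eij|nij] := eqVneq j i; last first.
    apply: nswap; exists i, j, (rem j (rem i Q)), (p1 ++ q2), (q1 ++ p2); split.
    - apply: perm_trans (perm_to_rem iQ) _; rewrite perm_cons perm_to_rem //.
      by have := perm_mem (perm_to_rem iQ) j; rewrite jQ inE (negbTE nij).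
    - exact: walk_cat w1 v2.
    - exact: walk_cat v1 w2.
    - by rewrite Ei Ej; eqd_solve.
    have := eQ i iQ; have := eQ j jQ; rewrite Ei Ej !pr_cat o1 e1.
    by case: (pr p2); case: (pr q2).
  subst j; have E : p1 ++ p2 = q1 ++ q2 by rewrite -Ei.
  case: (prefix_cases E) => [[r [Eq E2]]|[r [Ep E2]]].
    have wr : walk y r y by apply: (walk_suffix w1); rewrite -Eq.
    apply: (no_odd_loop i p1 r q2 y) => //; first by rewrite Ei E2.
    by move: e1; rewrite Eq pr_cat o1; case: (pr r).
  have wr : walk y r y by apply: (walk_suffix v1); rewrite -Ep.
  apply: (no_odd_loop i q1 r p2 y) => //; first by rewrite Ej E2.
  by move: o1; rewrite Ep pr_cat e1.
have reachedE c i p1 p2 y : i \in Q -> i.2 = p1 ++ p2 -> walk i.1.1 p1 y ->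
    pr p1 = c -> `[< reached true y >] = c.
  move=> iQ Ei w1; case: c => o1; first by apply/asboolP; exists i, p1, p2.
  by apply/asboolP => r; apply: (consistent y r); exists i, p1, p2.
exists (fun y => `[< reached true y >]) => [h hH|d].
  apply/asboolP => -[i [p1 [p2 [iQ Ei w1 o1]]]]; apply: nsplit.
  have [it ia ib] := hQ i iQ.
  exists i, (rem i Q), h, p1, p2; split=> //; first exact: perm_to_rem.
  - by split=> //; apply: (walk_suffix w1); rewrite -Ei.
  - by rewrite Ei.
  by split=> //; have := eQ i iQ; rewrite Ei pr_cat o1; case: (pr p2).
case/flattenP=> p /mapP[i iQ ->] /splitPr; case Ei: _ / => [p1 p2].
have [it _ _] := hQ i iQ; move: it; rewrite /itrail Ei => /walk_catE[y w1].
case/andP=> /eqP sd w2.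
rewrite (reachedE (pr p1) i p1 (d :: p2)) ?sd //.
rewrite (reachedE (pr (rcons p1 d)) i (rcons p1 d) p2) ?cat_rcons //; last first.
  by rewrite -cats1; apply: walk_cat w1 _; rewrite /= sd !eqxx.
by rewrite -cats1 pr_cat pr_cons /= addKb addbF.
Qed.

End Parity.

(** * Removing a vertex from the hub *)

Section Augmentation.
Variables (V : finType) (D : eqType) (src : D -> V) (rv : D -> D).
Hypothesis rvK : involutive rv.
Variable par : D -> bool.
Hypothesis par_rv : forall d, par (rv d) = par d.

Notation tgt := (tgt src rv).
Notation walk := (walk src rv).
Notation verts := (verts src rv).
Notation rw := (rw rv).
Notation eqd := (eqd rv).
Notation cross := (cross src rv).
Notation pr := (pr par).

Variables (U : {set V}) (x : V).
Hypothesis xU : x \notin U.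

(* Walks from [U] to [U], from [U] to [x], and from [x] to [x], in this order. *)
Definition conf : Type := (seq (seq D) * seq (seq D) * seq (seq D))%type.
Definition cA (c : conf) := c.1.1.
Definition cF (c : conf) := c.1.2.
Definition cC (c : conf) := c.2.
Definition isA p := exists a b, [/\ a \in U, b \in U & walk a p b].
Definition isF p := exists2 a, a \in U & walk a p x.
Definition isC p : Prop := walk x p x.
Definition conf_ok c := [/\ {in cA c, forall p, isA p}, {in cF c, forall p, isF p} &
  {in cC c, forall p, isC p}].
Definition conf_darts c := flatten (cA c) ++ flatten (cF c) ++ flatten (cC c).
Definition conf_odd c := count pr (cA c) + count pr (cF c) + count pr (cC c).

(* Augmenting chains, as in Menger's theorem: if a walk from [U] to [U] visits
   [y] and [linked c n y], successive recombinations with walks from [U] to [x]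
   end in an extra pair of walks from [U] to [x]. *)
Fixpoint linked c n y := if n is m.+1
  then exists F1 F2 u z, [/\ F1 ++ F2 \in cF c, u \in U, walk u F1 y /\ walk y F2 x,
         z \in verts u F1 & linked c m z]
  else y = x \/ exists2 C, C \in cC c & y \in verts x C.

Definition improves c c' := [/\ conf_ok c', eqd (conf_darts c') (conf_darts c) &
  conf_odd c <= conf_odd c'].

Lemma improves_trans c1 c2 c3 : improves c1 c2 -> improves c2 c3 -> improves c1 c3.
Proof.
move=> [_ e1 o1] [k2 e2 o2]; split=> //; last exact: leq_trans o2.
by move=> d; rewrite e2.
Qed.

(** Two walks through a common vertex have four arms. These are the two other ways to pair the arms;
    one of them yields no fewer odd walks. *)
Lemma recombine_parity (p1 p2 q1 q2 : bool) :
  ((p1 (+) p2) + (q1 (+) q2) <= (p1 (+) q2) + (q1 (+) p2)) ||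
  ((p1 (+) p2) + (q1 (+) q2) <= (p1 (+) q1) + (p2 (+) q2)).
Proof. by case: p1; case: p2; case: q1; case: q2. Qed.

Lemma count_rem_in (T : eqType) (P : pred T) y s : y \in s ->
  count P s = P y + count P (rem y s).
Proof. by move=> /perm_to_rem/permP->. Qed.

Lemma mem_neq_rem (T : eqType) (y z : T) s : y \in s -> y != z -> y \in rem z s.
Proof.
move=> ys nyz; have [zs|] := boolP (z \in s); last by move/rem_id->.
by have := perm_mem (perm_to_rem zs) y; rewrite ys inE (negbTE nyz).
Qed.

Lemma eqd_flatten_rem p s : p \in s -> eqd (flatten s) (p ++ flatten (rem p s)).
Proof. by move=> ps d; rewrite (cnt_flatten_perm _ _ (perm_to_rem ps)). Qed.

(** Replacing [F1] by [R] harms a chain only if one of its links is read off a vertex of [F1]; but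
    that link also links [y], in no more steps. *)
Lemma linked_swap c F1 F2 u y R a As m w :
  F1 ++ F2 \in cF c -> u \in U -> walk u F1 y -> walk y F2 x ->
  walk a R y -> a \in U -> linked c m w ->
  linked (As, (R ++ F2) :: rem (F1 ++ F2) (cF c), cC c) m w \/
  exists2 m', m' <= m & linked c m' y.
Proof.
move=> Fc uU w1 w2 wR aU; elim: m w => [|m IH] w; first by left.
case=> G1 [G2 [v [z [Gc vU [v1 v2] zG lz]]]].
have [l|[m' lm' ly]] := IH z lz; last by right; exists m'; rewrite // ltnW.
have [GF|nGF] := eqVneq (G1 ++ G2) (F1 ++ F2); last first.
  by left; exists G1, G2, v, z; split=> //; rewrite /cF /= inE mem_neq_rem ?orbT.
have vu : v = u.
  by apply: (walk_start_fun (walk_cat v1 v2)); rewrite GF; apply: walk_cat w1 w2.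
subst v.
have short : z \in verts u F1 -> exists2 m', m' <= m.+1 & linked c m' y.
  by move=> zF; exists m.+1 => //; exists F1, F2, u, z.
case: (prefix_cases GF) => [[r [E _]]|[r [E EF]]].
  by right; apply: short; rewrite E (verts_cat _ _ v1) zG.
move: zG; rewrite E (verts_cat _ _ w1) => /orP[/short|zr]; first by right.
left; exists (R ++ r), G2, a, z; rewrite -catA -EF /cF /= mem_head; split=> //.
  by split=> //; apply: walk_cat wR _; apply: (walk_suffix w1); rewrite -E.
by rewrite (verts_cat _ _ wR) zr orbT.
Qed.

(** Induction on the length of the chain. At length 0 the walk [E] is cut at [y] into two walks to
    [x], directly or with the help of a closed walk at [x]. Otherwise [E] and [F1 ++ F2] are
    recombined at [y] without losing odd walks; the new walk from [U] to [U] contains all of [F1],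
    hence [z], whose chain is shorter. If the exchange breaks that chain, [y] already had a shorter
    one. *)
Lemma augment n As Fs Cs E a b y : conf_ok (E :: As, Fs, Cs) ->
  a \in U -> b \in U -> walk a E b -> y \in verts a E -> linked (E :: As, Fs, Cs) n y ->
  exists2 c, improves (E :: As, Fs, Cs) c & size Fs < size (cF c).
Proof.
elim/ltn_ind: n As Fs Cs E a b y => n IH As Fs Cs E a b y ok aU bU wE yE ln.
have [E1 [E2 [EE e1 e2]]] := vertsP wE yE.
have [okA okF okC] := ok.
have okA' : {in As, forall p, isA p} by move=> p pA; apply: okA; rewrite inE pA orbT.
case: n IH ln => [|n] IH /=.
  case=> [yx|[C Cc yC]].
    subst y; exists (As, E1 :: rw E2 :: Fs, Cs) => //=; split.
    - split=> // p; rewrite !inE => /or3P[/eqP->|/eqP->|/okF//]; first by exists a.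
      by exists b => //; apply: walk_rw.
    - by rewrite /conf_darts /cA /cF /cC EE /=; eqd_solve.
    rewrite /conf_odd /cA /cF /cC /= pr_rw // EE pr_cat.
    by clear; case: (pr E1); case: (pr E2); rewrite /=; lia.
  have [C1 [C2 [EC c1 c2]]] := vertsP (okC C Cc) yC.
  have okC' : {in rem C Cs, forall p, isC p} by move=> p /mem_rem/okC.
  have cntC := eqd_flatten_rem Cc.
  have oddC := count_rem_in pr Cc.
  have := recombine_parity (pr E1) (pr E2) (pr C1) (pr C2).
  case/orP=> hle.
    exists (As, (E1 ++ C2) :: (rw E2 ++ rw C1) :: Fs, rem C Cs) => //=; split.
    - split=> // p; rewrite !inE => /or3P[/eqP->|/eqP->|/okF//].
        by exists a => //; apply: walk_cat e1 c2.
      by exists b => //; apply: walk_cat (walk_rw rvK e2) (walk_rw rvK c1).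
    - by move: cntC; rewrite /conf_darts /cA /cF /cC /= EC EE => cntC; eqd_solve.
    rewrite /conf_odd /cA /cF /cC /= in oddC *.
    by rewrite oddC EC EE !(pr_cat, pr_rw) //; move: hle; clear; lia.
  exists (As, (E1 ++ rw C1) :: (rw E2 ++ C2) :: Fs, rem C Cs) => //=; split.
  - split=> // p; rewrite !inE => /or3P[/eqP->|/eqP->|/okF//].
      by exists a => //; apply: walk_cat e1 (walk_rw rvK c1).
    by exists b => //; apply: walk_cat (walk_rw rvK e2) c2.
  - move: cntC; rewrite /conf_darts /cA /cF /cC /= EC EE => cntC.
    by eqd_solve.
  rewrite /conf_odd /cA /cF /cC /= in oddC *.
  by rewrite oddC EC EE !(pr_cat, pr_rw) //; move: hle; clear; lia.
case=> F1 [F2 [u [z [Fc uU [w1 w2] zF lz]]]].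
have cntF := eqd_flatten_rem Fc.
have oddF := count_rem_in pr Fc.
have okF' : {in rem (F1 ++ F2) Fs, forall p, isF p} by move=> p /mem_rem/okF.
have swap v1 v2 A0 R : v1 \in U -> v2 \in U -> walk y A0 v2 -> walk v1 R y ->
    eqd (A0 ++ R) E -> pr E + pr (F1 ++ F2) <= pr (F1 ++ A0) + pr (R ++ F2) ->
    exists2 c, improves (E :: As, Fs, Cs) c & size Fs < size (cF c).
  move=> v1U v2U wA wR EA hle.
  have := linked_swap ((F1 ++ A0) :: As) Fc uU w1 w2 wR v1U lz.
  case=> [l|[m' lm' l]]; last exact: (IH m' lm' _ _ _ _ _ _ _ ok aU bU wE yE l).
  have ok' : conf_ok ((F1 ++ A0) :: As, (R ++ F2) :: rem (F1 ++ F2) Fs, Cs).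
    split=> // p; rewrite inE => /predU1P[->|]; first idtac.
    - by exists u, v2; split=> //; apply: walk_cat w1 wA.
    - exact: okA'.
    - by exists v1 => //; apply: walk_cat wR w2.
    exact: okF'.
  have zA : z \in verts u (F1 ++ A0) by rewrite (verts_cat _ _ w1) zF.
  have [c ic sc] := IH n (ltnSn n) _ _ _ _ _ _ _ ok' uU v2U (walk_cat w1 wA) zA l.
  exists c; last by move: sc; rewrite /= size_rem // prednK //; case: (Fs) Fc.
  apply: improves_trans ic; split=> //.
    by move: cntF; rewrite /conf_darts /cA /cF /cC /= => cntF; eqd_solve.
  by rewrite /conf_odd /cA /cF /cC /=; rewrite /cF /= in oddF; rewrite oddF; move: hle; clear; lia.
have := recombine_parity (pr E1) (pr E2) (pr F1) (pr F2).
case/orP=> hle.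
  apply: (swap a b E2 E1) => //; first by rewrite EE; eqd_solve.
  by rewrite EE !pr_cat; move: hle; clear; lia.
apply: (swap b a (rw E1) (rw E2)) => //; [exact: walk_rw|exact: walk_rw|..].
  by rewrite EE; eqd_solve.
by rewrite EE !(pr_cat, pr_rw) //; move: hle; clear; lia.
Qed.

Lemma cross_once (Z : {set V}) u F : walk u F x -> u \notin Z -> x \in Z ->
  (forall F1 F2 y z, F = F1 ++ F2 -> walk u F1 y -> z \in verts u F1 ->
     z \in Z -> y \in Z) ->
  count (cross Z) F = 1.
Proof.
elim: F u => [u /eqP-> /negbTE-> //|d F IH] u /= /andP[/eqP sd w] uZ xZ h.
have [tZ|tZ] := boolP (tgt d \in Z).
  rewrite (cross_const (c := true) w) ?/cross ?sd ?tZ ?(negbTE uZ) // => y.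
  case/(vertsP w)=> F1 [F2 [E w1 _]].
  apply: (h (d :: F1) F2 y (tgt d)) tZ; rewrite ?E //= ?sd ?eqxx //.
  by rewrite !inE eqxx orbT.
rewrite (IH _ w) // ?/cross ?sd ?(negbTE uZ) ?(negbTE tZ) // => F1 F2 y z E w1 zF zZ.
apply: (h (d :: F1) F2 y z); rewrite ?E //= ?sd ?eqxx //.
by move: zF; rewrite !inE => ->; rewrite orbT.
Qed.

(* If no chain augments, the linked vertices form a cut crossed exactly once by
   every walk from [U] to [x] and by no other walk. *)
Lemma linked_cut c : conf_ok c ->
  (forall n y, y \in U -> ~ linked c n y) ->
  (forall n E a b y, E \in cA c -> a \in U -> b \in U -> walk a E b ->
     y \in verts a E -> ~ linked c n y) ->
  exists2 Z : {set V}, [disjoint Z & U] /\ x \in Z &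
    count (cross Z) (conf_darts c) = size (cF c).
Proof.
move=> [okA okF okC] nU nA.
pose Z := [set y | `[< exists n, linked c n y >]].
have ZP n y : linked c n y -> y \in Z.
  by move=> l; rewrite inE; apply/asboolP; exists n.
have nUZ y : y \in U -> y \notin Z.
  by move=> yU; rewrite inE; apply/asboolP => -[n]; apply: nU.
have xZ : x \in Z by apply: (ZP 0); left.
exists Z.
  split=> //; rewrite disjoint_sym; apply/pred0P => y /=.
  by apply/negbTE/negP => /andP[/nUZ/negP].
rewrite /conf_darts !count_cat !count_flatten !sumnE !big_map.
rewrite big_seq big1 ?add0n => [|E Ec].
  rewrite [X in _ + X]big_seq [X in _ + X]big1 ?addn0 => [|C Cc].
    rewrite big_seq (eq_bigr (fun=> 1)) => [|F Fc]; first by rewrite -big_seq sum1_size.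
    have [u uU w] := okF F Fc; have wF := w; apply: cross_once w (nUZ u uU) xZ _.
    move=> F1 F2 y z E w1 zF; rewrite inE => /asboolP[n l].
    apply: (ZP n.+1); exists F1, F2, u, z; split=> //; rewrite -?E //.
    by split=> //; apply: (walk_suffix w1); rewrite -E.
  by apply: (cross_const (c := true) (okC C Cc)) => y yC; apply: (ZP 0); right; exists C.
have [a [b [aU bU w]]] := okA E Ec.
have wE := w; apply: (cross_const (c := false) w) => y yE; apply/negbTE.
by rewrite inE; apply/asboolP => -[n]; apply: (nA n E a b y).
Qed.

(** Walks from [U] to [x] are nonempty because [x] lies outside [U]. The bound makes the
    augmentations in [saturate] terminate. *)
Lemma size_cF c : conf_ok c -> size (cF c) <= size (conf_darts c).
Proof.
move=> [_ okF _]; rewrite /conf_darts !size_cat; apply: leq_trans (leq_addl _ _).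
apply: leq_trans (leq_addr _ _); elim: (cF c) okF => //= F Fs IH okF.
rewrite size_cat; have := IH (fun p h => okF p (mem_behead (s := F :: Fs) h)).
case: F okF => [|d F] okF; last by rewrite /=; lia.
have [u uU /eqP ux] := okF [::] (mem_head _ _).
by move: uU; rewrite ux (negbTE xU).
Qed.

Lemma saturate c : conf_ok c -> exists c', improves c c' /\
  exists2 Z : {set V}, [disjoint Z & U] /\ x \in Z &
    count (cross Z) (conf_darts c') = size (cF c').
Proof.
have [n] := ubnP (size (conf_darts c) - size (cF c)).
elim: n c => // n IH c sn ok.
have again c1 c2 : improves c c1 -> improves c1 c2 -> size (cF c) < size (cF c2) ->
    exists c', improves c c' /\ exists2 Z : {set V}, [disjoint Z & U] /\ x \in Z &
      count (cross Z) (conf_darts c') = size (cF c').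
  move=> i1 i2 s; have i3 := improves_trans i1 i2; have [ok2 e2 _] := i3.
  have [|//|c3 [i4 h]] := IH c2.
    by move: (size_cF ok2) sn s; rewrite (eqd_size rvK e2); clear; lia.
  by exists c3; split=> //; apply: improves_trans i4.
have [[m [y [yU l]]]|nU] := pselect (exists m y, y \in U /\ linked c m y).
  (* A chain at a vertex of [U] is started by an additional empty walk there, which uses no edge. *)
  have ok1 : conf_ok ([::] :: cA c, cF c, cC c).
    case: ok => okA okF okC; split=> // p; rewrite inE => /predU1P[->|/okA//].
    by exists y, y; split=> //=.
  have l1 : linked ([::] :: cA c, cF c, cC c) m y.
    by elim: m y l {yU ok1} => [//|m IHm] y [F1 [F2 [u [z [h1 h2 h3 h4 /IHm h5]]]]];
      exists F1, F2, u, z.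
  have [c2 i2 s2] := augment ok1 yU yU (eqxx y) (mem_head _ _) l1.
  by apply: again i2 s2.
have [[m [E [a [b [y [[Ec aU bU] w yE l]]]]]]|nA] := pselect (exists m E a b y,
    [/\ [/\ E \in cA c, a \in U & b \in U], walk a E b, y \in verts a E & linked c m y]).
  have ok1 : conf_ok (E :: rem E (cA c), cF c, cC c).
    case: ok => okA okF okC; split=> // p.
    by rewrite inE => /predU1P[->|/mem_rem/okA//]; apply: okA.
  have l1 : linked (E :: rem E (cA c), cF c, cC c) m y.
    by elim: m y l {yE ok1} => [//|m IHm] y [F1 [F2 [u [z [h1 h2 h3 h4 /IHm h5]]]]];
      exists F1, F2, u, z.
  have [c2 i2 s2] := augment ok1 aU bU w yE l1.
  apply: again i2 s2; split=> //.
    have := eqd_flatten_rem Ec; rewrite /conf_darts /cA /cF /cC /= => h.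
    by eqd_solve.
  by rewrite /conf_odd /cA /cF /cC /= (count_rem_in pr Ec).
have [Z hZ cZ] := linked_cut ok (fun m y yU l => nU (ex_intro _ m (ex_intro _ y (conj yU l))))
  (fun m E a b y h1 h2 h3 h4 h5 h6 => nA (ex_intro _ m (ex_intro _ E (ex_intro _ a
    (ex_intro _ b (ex_intro _ y (And4 (And3 h1 h2 h3) h4 h5 h6))))))).
by exists c; split; [split|exists Z].
Qed.

End Augmentation.

(** * Joining walks at [x] into two odd walks *)

Section Recombination.
Variables (V : finType) (D : eqType) (src : D -> V) (rv : D -> D).
Hypothesis rvK : involutive rv.
Variable par : D -> bool.
Hypothesis par_rv : forall d, par (rv d) = par d.

Notation rw := (rw rv).
Notation eqd := (eqd rv).
Notation pr := (pr par).
Notation hubbed := (hubbed src rv).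

Definition odd_items (Q : seq (item V D)) := count (fun i => pr i.2) Q.

Definition two_odd (U : {set V}) L :=
  exists Q, [/\ hubbed U Q, eqd (flat Q) L & 2 <= odd_items Q].

Variables (U : {set V}) (x : V).

Notation isA := (isA src rv U).
Notation isF := (isF src rv U x).
Notation isC := (isC src rv x).
Definition npar e (s : seq (seq D)) := count (fun p => pr p == e) s.

Lemma npar_size s : npar true s + npar false s = size s.
Proof.
rewrite /npar -[RHS](count_predC (fun p => pr p == true)); congr addn.
by apply: eq_count => p /=; case: pr.
Qed.

Lemma npar_rem e p s : p \in s -> npar e s = (pr p == e) + npar e (rem p s).
Proof. exact: count_rem_in. Qed.

Lemma npar_pick e s : 0 < npar e s -> exists2 p, p \in s & pr p = e.
Proof. by rewrite -has_count => /hasP[p ps /eqP]; exists p. Qed.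

Lemma mixed_pair (Fs : seq (seq D)) : {in Fs, forall p, isF p} ->
  0 < npar true Fs -> 0 < npar false Fs ->
  exists i (Fs' : seq (seq D)), [/\ hubbed U [:: i] /\ pr i.2, {in Fs', forall p, isF p},
    npar true Fs = (npar true Fs').+1, npar false Fs = (npar false Fs').+1 &
    eqd (i.2 ++ flatten Fs') (flatten Fs)].
Proof.
move=> ok /npar_pick[f fF of_] /npar_pick[g gF eg].
have gF' : g \in rem f Fs.
  by apply: mem_neq_rem => //; apply: contraTneq of_ => <-; rewrite eg.
have [a aU wf] := ok f fF; have [b bU wg] := ok g gF.
exists (a, b, f ++ rw g), (rem g (rem f Fs)); split.
- split; last by rewrite /= pr_cat pr_rw // of_ eg.
  by move=> i; rewrite inE => /eqP->; split=> //=; apply: walk_cat wf (walk_rw rvK wg).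
- by move=> p /mem_rem/mem_rem/ok.
- by rewrite (npar_rem _ fF) (npar_rem _ gF') of_ eg.
- by rewrite (npar_rem _ fF) (npar_rem _ gF') of_ eg.
have h1 := eqd_flatten_rem rv fF; have h2 := eqd_flatten_rem rv gF'.
by eqd_solve.
Qed.

Lemma looped_pair e (Fs Cs : seq (seq D)) :
  {in Fs, forall p, isF p} -> {in Cs, forall p, isC p} ->
  1 < npar e Fs -> 0 < npar true Cs ->
  exists i (Fs' Cs' : seq (seq D)), [/\ hubbed U [:: i] /\ pr i.2,
    {in Fs', forall p, isF p} /\ {in Cs', forall p, isC p},
    size Fs = (size Fs').+2 /\ npar e Fs = (npar e Fs').+2,
    npar true Cs = (npar true Cs').+1 &
    eqd (i.2 ++ flatten Fs' ++ flatten Cs') (flatten Fs ++ flatten Cs)].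
Proof.
move=> okF okC Ne /npar_pick[c cC oc].
have [f fF pf] : exists2 p, p \in Fs & pr p = e by apply: npar_pick; lia.
have [g gF pg] : exists2 p, p \in rem f Fs & pr p = e.
  by apply: npar_pick; move: Ne; rewrite (npar_rem _ fF) pf eqxx.
have [a aU wf] := okF f fF; have [b bU wg] := okF g (mem_rem gF).
exists (a, b, f ++ c ++ rw g), (rem g (rem f Fs)), (rem c Cs); split.
- split; last by rewrite /= !pr_cat pr_rw // pf pg oc; case: (e).
  move=> i; rewrite inE => /eqP->; split=> //=; apply: walk_cat wf _.
  by apply: walk_cat (okC c cC) (walk_rw rvK wg).
- by split=> p => [/mem_rem/mem_rem/okF|/mem_rem/okC].
- split; last by rewrite (npar_rem _ fF) (npar_rem _ gF) pf pg eqxx.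
  by rewrite (perm_size (perm_to_rem fF)) /= (perm_size (perm_to_rem gF)).
- by rewrite (npar_rem _ cC) oc.
have h1 := eqd_flatten_rem rv fF; have h2 := eqd_flatten_rem rv gF.
have h3 := eqd_flatten_rem rv cC.
by eqd_solve.
Qed.

Lemma join_pairs (Fs : seq (seq D)) : {in Fs, forall p, isF p} -> ~~ odd (size Fs) ->
  exists2 Q, hubbed U Q & eqd (flat Q) (flatten Fs).
Proof.
have [n] := ubnP (size Fs); elim: n Fs => // n IH [|f [|g Fs]] //= sn ok ev.
  by exists [::].
have [|||Q hQ eQ] := IH Fs; first exact: ltnW.
- by move=> p pF; apply: ok; rewrite !inE pF !orbT.
- by rewrite -[odd _]negbK.
have [a aU wf] := ok f (mem_head _ _).
have [b bU wg] : isF g by apply: ok; rewrite !inE eqxx orbT.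
exists ((a, b, f ++ rw g) :: Q).
  move=> i; rewrite inE => /predU1P[->|/hQ//]; split=> //=.
  exact: walk_cat wf (walk_rw rvK wg).
by rewrite flat_cons /=; eqd_solve.
Qed.

Lemma join_pairs_loops (Fs Cs : seq (seq D)) :
  {in Fs, forall p, isF p} -> {in Cs, forall p, isC p} ->
  ~~ odd (size Fs) -> 1 < size Fs ->
  exists2 Q, hubbed U Q & eqd (flat Q) (flatten Fs ++ flatten Cs).
Proof.
case: Fs => [|f [|g Fs]] //= okF okC ev _.
have okF' : {in Fs, forall p, isF p} by move=> p pF; apply: okF; rewrite !inE pF !orbT.
have [|Q hQ eQ] := join_pairs okF'; first by rewrite -[odd _]negbK.
have [a aU wf] := okF f (mem_head _ _).
have [b bU wg] : isF g by apply: okF; rewrite !inE eqxx orbT.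
exists ((a, b, f ++ flatten Cs ++ rw g) :: Q); last by rewrite flat_cons /=; eqd_solve.
move=> i; rewrite inE => /predU1P[->|/hQ//]; split=> //=; apply: walk_cat wf _.
apply: walk_cat (walk_rw rvK wg); elim: Cs okC => [|C Cs IH] okC /=; first exact: eqxx.
apply: walk_cat (okC C (mem_head _ _)) (IH _) => p pC.
by apply: okC; rewrite inE pC orbT.
Qed.

Lemma items_of (As : seq (seq D)) : {in As, forall p, isA p} ->
  exists2 Q, hubbed U Q & flat Q = flatten As.
Proof.
elim: As => [|p As IH] ok; first by exists [::].
have [q qA|Q hQ eQ] := IH; first by apply: ok; rewrite inE qA orbT.
have [a [b [aU bU w]]] := ok p (mem_head _ _).
exists ((a, b, p) :: Q); last by rewrite flat_cons eQ.
by move=> i; rewrite inE => /predU1P[->|/hQ//].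
Qed.

Lemma two_odd_intro i j c L : conf_ok src rv U x c ->
  hubbed U [:: i] /\ pr i.2 -> hubbed U [:: j] /\ pr j.2 ->
  2 %| size (cF c) -> 1 < size (cF c) ->
  eqd (i.2 ++ j.2 ++ conf_darts c) L -> two_odd U L.
Proof.
rewrite dvdn2 => -[okA okF okC] [hi oi] [hj oj] ev sF E.
have [Q1 h1 e1] := items_of okA; have [Q2 h2 e2] := join_pairs_loops okF okC ev sF.
exists (i :: j :: Q1 ++ Q2); split; last by rewrite /odd_items /= oi oj.
  move=> k; rewrite !inE mem_cat => /or4P[/eqP->|/eqP->|/h1//|/h2//].
    by apply: hi; rewrite inE.
  by apply: hj; rewrite inE.
move: E; rewrite !flat_cons flat_cat e1 /conf_darts => E.
by eqd_solve.
Qed.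

(* Walks from [U] to [x] are joined in pairs at [x], and the closed walks at [x]
   are inserted where they do not destroy the two odd walks. *)
Lemma recombine c : conf_ok src rv U x c -> 2 %| size (cF c) -> 6 <= size (cF c) ->
  2 <= conf_odd par c ->
  2 <= npar false (cF c) \/
    0 < npar false (cF c) /\ 0 < npar true (cA c) + npar true (cC c) ->
  two_odd U (conf_darts c).
Proof.
case: c => [[As Fs] Cs]; rewrite /conf_odd /cA /cF /cC /= => ok ev s6.
have NE s : count pr s = npar true s by apply: eq_count => p; rewrite eqb_id.
rewrite !NE => o2 h; have [okA okF okC] := ok; rewrite /cA /cF /cC /= in okA okF okC.
have sF := npar_size Fs.
have pickA (As1 : seq (seq D)) : {in As1, forall p, isA p} ->
    0 < npar true As1 -> exists i (As' : seq (seq D)),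
    [/\ hubbed U [:: i] /\ pr i.2, {in As', forall p, isA p},
      npar true As1 = (npar true As').+1 &
      eqd (i.2 ++ flatten As') (flatten As1)].
  move=> okA1 /npar_pick[p pA op]; have [a [b [aU bU w]]] := okA1 p pA.
  exists (a, b, p), (rem p As1); split.
  - by split=> // k; rewrite inE => /eqP->.
  - by move=> q /mem_rem/okA1.
  - by rewrite (npar_rem _ pA) op.
  by have h1 := eqd_flatten_rem rv pA; eqd_solve.
(* Each odd item built below consumes at most two of the six or more walks to [x], so a pair remains
   into which the leftover closed walks at [x] can be inserted. *)
have [a0|a1] := posnP (npar true As); last first.
  have [i [As1 [hi okA1 n1 e1]]] := pickA As okA a1.
  have [a2|a2] := posnP (npar true As1); last first.
    have [j [As2 [hj okA2 n2 e2]]] := pickA As1 okA1 a2.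
    apply: (@two_odd_intro i j (As2, Fs, Cs)) => //; first by rewrite /cF /=; lia.
    by rewrite /conf_darts /cA /cF /cC /=; eqd_solve.
  have [b0|b1] := posnP (npar true Fs).
    have [||j [Fs2 [Cs2 [hj [okF2 okC2] [s2 _] _ e2]]]] :=
      looped_pair (e := false) okF okC; [by lia|by lia|].
    apply: (@two_odd_intro i j (As1, Fs2, Cs2)) => //; rewrite /cF /=; [by lia|by lia|].
    by rewrite /conf_darts /cA /cF /cC /=; eqd_solve.
  have [||j [Fs2 [hj okF2 n2 n3 e2]]] := mixed_pair okF; [by lia|by lia|].
  have sF2 := npar_size Fs2.
  apply: (@two_odd_intro i j (As1, Fs2, Cs)) => //; rewrite /cF /=; [by lia|by lia|].
  by rewrite /conf_darts /cA /cF /cC /=; eqd_solve.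
have [b0|b1] := posnP (npar true Fs).
  have [||i [Fs1 [Cs1 [hi [okF1 okC1] [s1 n1] n2 e1]]]] :=
      looped_pair (e := false) okF okC; [by lia|by lia|].
  have [||j [Fs2 [Cs2 [hj [okF2 okC2] [s2 _] _ e2]]]] :=
      looped_pair (e := false) okF1 okC1; [by lia|by lia|].
  apply: (@two_odd_intro i j (As, Fs2, Cs2)) => //; rewrite /cF /=; [by lia|by lia|].
  by rewrite /conf_darts /cA /cF /cC /=; eqd_solve.
have [||i [Fs1 [hi okF1 n1 n2 e1]]] := mixed_pair okF; [by lia|by lia|].
have sF1 := npar_size Fs1.
have [c0|c1] := posnP (npar true Cs).
  have [||j [Fs2 [hj okF2 n3 n4 e2]]] := mixed_pair okF1; [by lia|by lia|].
  have sF2 := npar_size Fs2.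
  apply: (@two_odd_intro i j (As, Fs2, Cs)) => //; rewrite /cF /=; [by lia|by lia|].
  by rewrite /conf_darts /cA /cF /cC /=; eqd_solve.
(* At least four walks to [x] are left, so two of them have equal parity. *)
have [e Ne] : exists e, 1 < npar e Fs1.
  by case: (ltnP 1 (npar true Fs1)) => ?; [exists true|exists false; lia].
have [j [Fs2 [Cs2 [hj [okF2 okC2] [s2 _] _ e2]]]] := looped_pair okF1 okC Ne c1.
apply: (@two_odd_intro i j (As, Fs2, Cs2)) => //; rewrite /cF /=; [by lia|by lia|].
by rewrite /conf_darts /cA /cF /cC /=; eqd_solve.
Qed.

End Recombination.

(** * Switching signs at vertices *)

Section Switching.
Variables (V : finType) (D : eqType) (src : D -> V) (rv : D -> D).
Hypothesis rvK : involutive rv.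
Variable par : D -> bool.
Hypothesis par_rv : forall d, par (rv d) = par d.
Notation tgt := (tgt src rv).
Notation walk := (walk src rv).

Definition switch (s : V -> bool) d := par d (+) s (src d) (+) s (tgt d).

Lemma switch_rv s d : switch s (rv d) = switch s d.
Proof. by rewrite /switch par_rv tgt_rv // addbAC. Qed.

Lemma pr_switch s a p b : walk a p b -> pr (switch s) p = pr par p (+) s a (+) s b.
Proof.
elim: p a => [a /eqP->|d p IH a /= /andP[/eqP<- /IH]]; first by rewrite addbK.
rewrite !pr_cons => ->; rewrite /switch.
by case: (par d); case: (pr par p); do 3?[case: (s _)].
Qed.

(** Switching changes the parity of a walk only through the values of [s] at its two ends. *)
Lemma two_odd_switch (s s' : V -> bool) (U : {set V}) L : {in U, s =1 s'} ->
  two_odd src rv (switch s) U L -> two_odd src rv (switch s') U L.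
Proof.
move=> ss' [Q [hQ eQ oQ]]; exists Q; split=> //; apply: leq_trans oQ _.
rewrite /odd_items; apply: eq_leq; apply: eq_in_count => i /hQ[w iU jU].
by rewrite !(pr_switch _ w) !ss'.
Qed.

Lemma two_odd_eqd U L L' : eqd rv L L' ->
  two_odd src rv par U L -> two_odd src rv par U L'.
Proof. by move=> E [Q [hQ eQ oQ]]; exists Q; split=> // d; rewrite eQ. Qed.

End Switching.

(** * One vertex leaves the hub *)

Section Descent.
Variables (V : finType) (D : eqType) (src : D -> V) (rv : D -> D).
Hypothesis rvK : involutive rv.
Variable par : D -> bool.
Hypothesis par_rv : forall d, par (rv d) = par d.

Notation tgt := (tgt src rv).
Notation rw := (rw rv).
Notation eqd := (eqd rv).
Notation cross := (cross src rv).
Notation hubbed := (hubbed src rv).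

Variables (U : {set V}) (x : V).
Hypothesis xU : x \notin U.

Definition ftype (i : item V D) := (i.1.1 == x) != (i.1.2 == x).

Lemma classify (pa : D -> bool) Q : (forall d, pa (rv d) = pa d) -> hubbed (x |: U) Q ->
  exists c, [/\ conf_ok src rv U x c, eqd (conf_darts c) (flat Q),
    conf_odd pa c = odd_items pa Q, size (cF c) = count ftype Q &
    npar pa false (cF c) = count (fun i => ftype i && ~~ pr pa i.2) Q].
Proof.
move=> pa_rv; elim: Q => [|[[a b] p] Q IH] hQ; first by exists ([::], [::], [::]); split.
have [w aH bH] := hQ _ (mem_head _ _).
have [i iQ|[[As Fs] Cs] [[okA okF okC] E o sF nF]] := IH; first by apply: hQ; rewrite inE iQ orbT.
rewrite /cA /cF /cC /= in okA okF okC.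
move: sF nF o E; rewrite /conf_odd /conf_darts /cA /cF /cC /= => sF nF o E.
rewrite flat_cons /ftype /=.
have ub y : y \in x |: U -> y != x -> y \in U by rewrite !inE => /orP[->|].
have [ax|ax] := eqVneq a x; have [bx|bx] := eqVneq b x; rewrite /=.
- exists (As, Fs, p :: Cs); split=> //; rewrite /conf_darts /conf_odd /cA /cF /cC /=.
  + split=> // q; rewrite inE => /predU1P[->|/okC//].
    by move: w; rewrite /itrail /= ax bx.
  + by eqd_solve.
  by rewrite -o; lia.
- exists (As, rw p :: Fs, Cs); split=> //; rewrite /conf_darts /conf_odd /cA /cF /cC /=.
  + split=> // q; rewrite inE => /predU1P[->|/okF//].
    by exists b; [apply: ub|rewrite -ax; apply: walk_rw].
  + by eqd_solve.
  + by rewrite -o pr_rw //; lia.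
  + by rewrite sF.
  by rewrite nF pr_rw // eqbF_neg.
- exists (As, p :: Fs, Cs); split=> //; rewrite /conf_darts /conf_odd /cA /cF /cC /=.
  + split=> // q; rewrite inE => /predU1P[->|/okF//].
    by exists a; [apply: ub|rewrite -bx].
  + by eqd_solve.
  + by rewrite -o; lia.
  + by rewrite sF.
  by rewrite nF eqbF_neg.
exists (p :: As, Fs, Cs); split=> //; rewrite /conf_darts /conf_odd /cA /cF /cC /=.
- split=> // q; rewrite inE => /predU1P[->|/okA//].
  by exists a, b; split=> //; apply: ub.
- by eqd_solve.
by rewrite -o; lia.
Qed.

(** The orientation clause, by which an item starting at [x] also ends there, ensures that an
    exchange of tails does not lower the number of items with exactly one end at [x]. *)
Lemma conf_items c : conf_ok src rv U x c -> exists Q, [/\ hubbed (x |: U) Q,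
  map snd Q = cA c ++ cF c ++ cC c, (forall i, i \in Q -> i.1.1 = x -> i.1.2 = x) &
  count ftype Q = size (cF c)].
Proof.
case: c => [[As Fs] Cs] [okA okF okC]; rewrite /cA /cF /cC /= in okA okF okC *.
have xH : x \in x |: U by exact: setU11.
have uH y : y \in U -> y \in x |: U by move=> yU; exact: setU1r.
have nx y : y \in U -> (y == x) = false.
  by move=> yU; apply/negbTE; apply: contraNneq xU => <-.
elim: As okA => [|p As IH] okA.
  elim: Fs okF {okA} => [|p Fs IH] okF.
    elim: Cs okC {okF} => [|p Cs IH] okC; first by exists [::].
    have [q qC|Q [h1 h2 h3 h4]] := IH; first by apply: okC; rewrite inE qC orbT.
    exists ((x, x, p) :: Q); split=> /=; last by rewrite /ftype /= eqxx h4.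
    - by move=> i; rewrite inE => /predU1P[->|/h1//]; split=> //; apply: okC; rewrite mem_head.
    - by rewrite h2.
    by move=> i; rewrite inE => /predU1P[->|/h3].
  have [q qF|Q [h1 h2 h3 h4]] := IH; first by apply: okF; rewrite inE qF orbT.
  have [a aU w] := okF p (mem_head _ _).
  exists ((a, x, p) :: Q); split=> /=; last by rewrite /ftype /= eqxx nx // h4.
  - by move=> i; rewrite inE => /predU1P[->|/h1//]; split=> //; apply: uH.
  - by rewrite h2.
  by move=> i; rewrite inE => /predU1P[->|/h3].
have [q qA|Q [h1 h2 h3 h4]] := IH; first by apply: okA; rewrite inE qA orbT.
have [a [b [aU bU w]]] := okA p (mem_head _ _).
exists ((a, b, p) :: Q); split=> /=; last by rewrite /ftype /= !nx // h4.
- by move=> i; rewrite inE => /predU1P[->|/h1//]; split=> //; apply: uH.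
- by rewrite h2.
move=> i; rewrite inE => /predU1P[->|/h3//] /= ax.
by move: aU; rewrite ax (negbTE xU).
Qed.

(** Only walks with exactly one end at [x] cross the cut around [x] an odd number of times. *)
Lemma odd_size_cF c : conf_ok src rv U x c ->
  odd (size (cF c)) = odd (count (cross [set x]) (conf_darts c)).
Proof.
move=> [okA okF okC]; rewrite /conf_darts !count_cat !oddD.
have nx y : y \in U -> (y == x) = false.
  by move=> yU; apply/negbTE; apply: contraNneq xU => <-.
have -> : odd (count (cross [set x]) (flatten (cA c))) = false.
  elim: (cA c) okA => //= p s IH ok; rewrite count_cat oddD IH ?addbF => [|q qs]; last first.
    by apply: ok; rewrite inE qs orbT.
  have [a [b [aU bU w]]] := ok p (mem_head _ _).
  by rewrite (odd_cross _ w) !inE !nx.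
have -> : odd (count (cross [set x]) (flatten (cC c))) = false.
  elim: (cC c) okC => //= p s IH ok; rewrite count_cat oddD IH ?addbF => [|q qs]; last first.
    by apply: ok; rewrite inE qs orbT.
  by rewrite (odd_cross _ (ok p (mem_head _ _))) addbb.
rewrite addbF; elim: (cF c) okF => //= p s IH ok.
rewrite count_cat oddD -IH => [|q qs]; last by apply: ok; rewrite inE qs orbT.
have [a aU w] := ok p (mem_head _ _).
by rewrite (odd_cross _ w) !inE eqxx nx.
Qed.

Variable L : seq D.
Hypothesis even_L : ~~ odd (count (cross [set x]) L).
Hypothesis no_two_cut : forall Z : {set V}, count (cross Z) L != 2.
Hypothesis six : forall Z : {set V}, x \in Z -> [disjoint Z & U] -> 6 <= count (cross Z) L.
Hypothesis not_one : forall s, count (switch src rv par s) L != 1.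
Variable e : D.
Hypotheses (eU : src e \in U) (ex : tgt e = x) (ev_e : par e = false).
Hypothesis eL : (e \in L) || (rv e \in L).

(** Both ends of [e] are in the hub, so the item through [e] may be cut there; [e] being even, an
    odd item leaves an odd piece. *)
Lemma isolate_edge (Q : seq (item V D)) : hubbed (x |: U) Q -> eqd (flat Q) L ->
  exists Q', [/\ hubbed (x |: U) Q', eqd (e :: flat Q') L & odd_items par Q <= odd_items par Q'].
Proof.
move=> hQ eQ.
have [e' e'Q ee'] : exists2 e', e' \in flat Q & e' = e \/ e' = rv e.
  case/orP: eL => [/(eqd_mem (eqd_sym eQ))|/(eqd_mem (eqd_sym eQ))] /orP[h|h].
  - by exists e; [|left].
  - by exists (rv e); [|right].
  - by exists (rv e); [|right].
  by exists e; [rewrite -[e]rvK|left].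
have pe' : par e' = false by case: ee' => ->; rewrite ?par_rv.
have he' : src e' \in x |: U /\ tgt e' \in x |: U.
  by case: ee' => ->; rewrite ?tgt_rv // -?/(tgt e) !inE ex eU eqxx ?orbT.
have e1 : eqd [:: e'] [:: e] by case: ee' => -> // d; rewrite cnt_rv.
case/flattenP: e'Q => p /mapP[[[a b] q] iQ /= ->] /splitPr Eq.
case: Eq iQ => p1 p2 iQ.
have [w aH bH] := hQ _ iQ; have [c w1 w2] := walk_catE w.
have sc : c = src e' by apply: walk_start w2.
have [Q0 pQ] : exists Q0, perm_eq Q ((a, b, p1 ++ e' :: p2) :: Q0).
  by exists (rem (a, b, p1 ++ e' :: p2) Q); apply: perm_to_rem.
exists ((a, src e', p1) :: (tgt e', b, p2) :: Q0); split.
- case: he' => sH tH i; rewrite 2!in_cons => /or3P[/eqP->|/eqP->|iQ0].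
  + by split=> //; rewrite /itrail /= -sc.
  + by split=> //; case/andP: w2.
  by apply: hQ; rewrite (perm_mem pQ) inE iQ0 orbT.
- have h : eqd (flat Q) ((p1 ++ e' :: p2) ++ flat Q0).
    by move=> d; rewrite /flat (cnt_flatten_perm _ _ (perm_map snd pQ)).
  by rewrite !flat_cons /=; eqd_solve.
move/permP: pQ => /(_ (fun i => pr par i.2)); rewrite /odd_items /= => ->.
rewrite pr_cat pr_cons pe' /=.
by clear; case: (pr _ p1); case: (pr _ p2); rewrite /=; lia.
Qed.

(* Recombination fails only if [e] is the one even walk from [U] to [x] and all
   other walks would be even after switching at [x]; then
   [balanced_or_improvable] produces two odd walks among them. *)
Lemma two_odd_descent : two_odd src rv par (x |: U) L -> two_odd src rv par U L.
Proof.
case=> Q [hQ eQ oQ]; have [Q1 [hQ1 eQ1 oQ1]] := isolate_edge hQ eQ.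
have [c0 [ok0 e0 o0 _ _]] := classify par_rv hQ1.
have [c1 [[ok1 e1 o1] [Z [dZ xZ] cZ]]] := saturate rvK par_rv xU ok0.
have eL1 : eqd (e :: conf_darts c1) L by eqd_solve.
have crossL (Z' : {set V}) : count (cross Z') L = cross Z' e + count (cross Z') (conf_darts c1).
  by rewrite -(eqd_count rvK (cross_rv src rvK Z') eL1).
have eZ : cross Z e.
  rewrite /cross ex xZ; suff /negbTE-> : src e \notin Z by [].
  by apply: contraTN eU => sZ; rewrite (disjointFr dZ).
(* At least six edges leave [Z], and [e] is one of them; each of the others belongs to a different
   walk to [x]. *)
have s5 : 5 <= size (cF c1) by have := six xZ dZ; rewrite crossL eZ cZ; clear; lia.
have odd1 : 2 <= conf_odd par c1 by rewrite (leq_trans _ o1) // o0 (leq_trans oQ).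
have we : isF src rv U x [:: e] by exists (src e) => //; rewrite -ex; apply: walk1.
have ok_e c : conf_ok src rv U x c -> conf_ok src rv U x (cA c, [:: e] :: cF c, cC c).
  by case=> okA okF okC; split=> // p; rewrite inE => /predU1P[->|/okF].
have finish pa c : (forall d, pa (rv d) = pa d) -> conf_ok src rv U x c ->
    eqd (conf_darts c) (conf_darts c1) -> 5 <= size (cF c) -> 2 <= conf_odd pa c ->
    2 <= npar pa false ([:: e] :: cF c) \/ 0 < npar pa false ([:: e] :: cF c) /\
       0 < npar pa true (cA c) + npar pa true (cC c) ->
    two_odd src rv pa U L.
  move=> pa_rv ok E s o h.
  have E1 : eqd (conf_darts (cA c, [:: e] :: cF c, cC c)) L.
    rewrite [conf_darts _](_ : _ = flatten (cA c) ++ (e :: flatten (cF c)) ++ flatten (cC c)) //.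
    by move: E; rewrite {1}/conf_darts => E; eqd_solve.
  have E2 := E1; apply: two_odd_eqd E2 _; apply: recombine (ok_e _ ok) _ _ _ h => //.
    rewrite dvdn2 (odd_size_cF (ok_e _ ok)).
    by rewrite (eqd_count rvK (cross_rv src rvK _) E1).
  by rewrite (leq_trans o) // /conf_odd /= leq_add2r leq_add2l leq_addl.
have ev1 : pr par [:: e] = false by rewrite pr_cons ev_e.
have [AC|AC] := ltnP 0 (npar par true (cA c1) + npar par true (cC c1)).
  by apply: (finish par c1) => //; right; rewrite /npar /= ev1 /=.
move: AC; rewrite leqn0 addn_eq0 => /andP[/eqP nA /eqP nC].
have [nF|] := ltnP 0 (npar par false (cF c1)).
  by apply: (finish par c1) => //; left; rewrite {1}/npar /= ev1.
(* In the remaining case all walks to [x] other than [e] are odd and all other walks are even.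
   Switching at [x] makes all of them even and [e] odd. *)
rewrite leqn0 => /eqP nF; pose sx y := y == x; pose pa := switch src rv par sx.
have pa_rv : forall d, pa (rv d) = pa d by apply: switch_rv.
have pae : pa e by rewrite /pa /switch ev_e ex /sx eqxx; case: eqP eU xU => // -> ->.
have nx y : y \in U -> sx y = false.
  by move=> yU; apply/negbTE; apply: contraNneq xU => <-.
have [okA1 okF1 okC1] := ok1.
have ev p : p \in cA c1 ++ cF c1 ++ cC c1 -> ~~ pr pa p.
  rewrite !mem_cat => /or3P[pA|pF|pC].
  - have [a [b [aU bU w]]] := okA1 p pA; rewrite (pr_switch par _ w) !nx // !addbF.
    apply/negP => op; suff: 0 < npar par true (cA c1) by rewrite nA.
    by rewrite -has_count; apply/hasP; exists p => //; rewrite op.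
  - have [a aU w] := okF1 p pF; rewrite (pr_switch par _ w) nx // /sx eqxx addbF addbT negbK.
    apply/negPn/negP => op; suff: 0 < npar par false (cF c1) by rewrite nF.
    by rewrite -has_count; apply/hasP; exists p => //; rewrite (negbTE op).
  rewrite (pr_switch par _ (okC1 p pC)) addbK.
  apply/negP => op; suff: 0 < npar par true (cC c1) by rewrite nC.
  by rewrite -has_count; apply/hasP; exists p => //; rewrite op.
have [Q2 [hQ2 mQ2 orQ2 nQ2]] := conf_items ok1.
have fQ2 : flat Q2 = conf_darts c1 by rewrite /flat mQ2 !flatten_cat.
have evQ2 i : i \in Q2 -> ~~ pr pa i.2.
  by move=> iQ; apply: ev; rewrite -mQ2 map_f.
suff: two_odd src rv pa U L.
  case=> Q3 [hQ3 eQ3 oQ3]; exists Q3; split=> //; apply: leq_trans oQ3 _.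
  rewrite /odd_items; apply: eq_leq; apply: eq_in_count => i /hQ3[w iU jU].
  by rewrite (pr_switch par _ w) !nx // !addbF.
have improved Q3 : hubbed (x |: U) Q3 -> eqd (flat Q3) (flat Q2) -> 2 <= odd_items pa Q3 ->
    count ftype Q2 <= count ftype Q3 ->
    2 <= count (fun i => ftype i && ~~ pr pa i.2) Q3 -> two_odd src rv pa U L.
  move=> hQ3 eQ3 oQ3 f3 n3; have [c3 [ok3 e3 o3 s3 N3]] := classify pa_rv hQ3.
  apply: (finish pa c3) => //.
  - by rewrite -fQ2; eqd_solve.
  - by rewrite s3 (leq_trans _ f3) // nQ2.
  - by rewrite o3.
  by left; rewrite /npar /= -/(npar pa false (cF c3)) N3 (leq_trans n3) // leq_addl.
have evF Q0 : {subset Q0 <= Q2} ->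
    count (fun i => ftype i && ~~ pr pa i.2) Q0 = count ftype Q0.
  by move=> sQ; apply: eq_in_count => i /sQ/evQ2->; rewrite andbT.
case: (balanced_or_improvable rvK pa_rv hQ2 evQ2).
- move=> [i [Q0 [c [p1 [p2 [pQ cH [w1 w2] ei [op1 op2]]]]]]].
  have sQ0 : {subset Q0 <= Q2} by move=> k kQ; rewrite (perm_mem pQ) inE kQ orbT.
  have iQ : i \in Q2 by rewrite (perm_mem pQ) mem_head.
  have [w iH jH] := hQ2 i iQ.
  have fi : ftype i <= ftype (i.1.1, c, p1) + ftype (c, i.1.2, p2).
    by rewrite /ftype /=; case: (_ == x); case: (_ == x); case: (_ == x).
  have cQ : count ftype Q2 = ftype i + count ftype Q0 by move/permP: pQ => ->.
  apply: (improved ((i.1.1, c, p1) :: (c, i.1.2, p2) :: Q0)).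
  + by move=> k; rewrite 2!in_cons => /or3P[/eqP->|/eqP->|/sQ0/hQ2//].
  + have h : eqd (flat Q2) (i.2 ++ flat Q0).
      by move=> d; rewrite /flat (cnt_flatten_perm _ _ (perm_map snd pQ)).
    by rewrite !flat_cons; eqd_solve.
  + by rewrite /odd_items /= op1 op2.
  + by rewrite cQ /= addnA leq_add2r.
  rewrite /= evF //; move: s5; rewrite -nQ2 cQ; clear.
  by have := leq_b1 (ftype i); lia.
- move=> [i [j [Q0 [p [q [pQ w1 w2 eij [op1 op2]]]]]]].
  have sQ0 : {subset Q0 <= Q2} by move=> k kQ; rewrite (perm_mem pQ) !inE kQ !orbT.
  have iQ : i \in Q2 by rewrite (perm_mem pQ) mem_head.
  have jQ : j \in Q2 by rewrite (perm_mem pQ) !inE eqxx orbT.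
  have [wi iH iH'] := hQ2 i iQ; have [wj jH jH'] := hQ2 j jQ.
  have fij : ftype i + ftype j <= ftype (i.1.1, j.1.2, p) + ftype (j.1.1, i.1.2, q).
    have oi := orQ2 i iQ; have oj := orQ2 j jQ; rewrite /ftype /=.
    have [/oi->|_] := eqVneq i.1.1 x; have [/oj->|_] := eqVneq j.1.1 x; rewrite ?eqxx //=;
      by do 2?[case: (_ == x)].
  have cQ : count ftype Q2 = ftype i + (ftype j + count ftype Q0) by move/permP: pQ => ->.
  apply: (improved ((i.1.1, j.1.2, p) :: (j.1.1, i.1.2, q) :: Q0)).
  + by move=> k; rewrite 2!in_cons => /or3P[/eqP->|/eqP->|/sQ0/hQ2//].
  + have h : eqd (flat Q2) (i.2 ++ j.2 ++ flat Q0).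
      by move=> d; rewrite /flat (cnt_flatten_perm _ _ (perm_map snd pQ)).
    by rewrite !flat_cons; eqd_solve.
  + by rewrite /odd_items /= op1 op2.
  + by rewrite cQ /= !addnA leq_add2r.
  rewrite /= evF //; move: s5; rewrite -nQ2 cQ; clear.
  by have := leq_b1 (ftype i); have := leq_b1 (ftype j); lia.
- move=> [Z' [dZ' nZ' cZ']]; case/eqP: (no_two_cut Z').
  rewrite crossL -fQ2 cZ' /cross ex !(disjointFl dZ') ?setU11 //.
  exact: setU1r.
(* Switching by [tau] and at [x] together would leave [e] as the only negative edge. *)
case=> tau tau0 tauE; case/eqP: (not_one (fun y => tau y (+) sx y)).
rewrite -(eqd_count rvK (switch_rv src rvK par_rv _) eL1) /=.
rewrite [X in _ + X](_ : _ = 0) ?addn0; last first.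
  apply/eqP; rewrite -leqn0 leqNgt -has_count; apply/hasPn => d; rewrite -fQ2 => dQ.
  have := tauE d dQ; rewrite /pa /switch -/(tgt d) => h; apply/negP.
  by move: h; case: (par d); case: (sx _); case: (sx _); case: (tau _); case: (tau _).
by rewrite /switch ev_e ex !tau0 ?setU11 ?setU1r // nx // /sx eqxx.
Qed.

End Descent.

(** * Three odd closed walks in the absence of small cuts *)

Section Core.
Variables (V : finType) (D : eqType) (src : D -> V) (rv : D -> D).
Hypothesis rvK : involutive rv.
Variable par : D -> bool.
Hypothesis par_rv : forall d, par (rv d) = par d.

Notation tgt := (tgt src rv).
Notation walk := (walk src rv).
Notation verts := (verts src rv).
Notation eqd := (eqd rv).
Notation cross := (cross src rv).
Notation hubbed := (hubbed src rv).
Notation switch := (switch src rv).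

Variables (v0 : V) (w : seq D).
Hypothesis closed_w : walk v0 w v0.
Hypothesis odd_w : pr par w.
Notation cut Z := (count (cross Z) w).
Hypothesis no_two_cut : forall Z : {set V}, cut Z != 2.
Hypothesis unbalanced_four_cut : forall (Z : {set V}) s, cut Z = 4 ->
  exists2 d, d \in w & [/\ src d \in Z, tgt d \in Z & switch par s d].
Hypothesis not_one : forall s, count (switch par s) w != 1.

Let S := [set v in verts v0 w].

Lemma even_cut Z : ~~ odd (cut Z).
Proof. by rewrite (odd_cross _ closed_w) addbb. Qed.

Lemma dart_in_S d : d \in w -> src d \in S /\ tgt d \in S.
Proof. by rewrite !in_set => /(dart_verts closed_w). Qed.

Lemma cut_ge4 (Z : {set V}) u u' : u \in S -> u \in Z -> u' \in S -> u' \notin Z -> 4 <= cut Z.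
Proof.
rewrite !in_set => uS uZ uS' uZ'; have := even_cut Z; have := no_two_cut Z.
have : cut Z != 0; last by clear; case: count => [|[|[|[|k]]]].
by apply/eqP => c0; move: uZ'; rewrite (walk_cross0 closed_w c0) // -(walk_cross0 closed_w c0 uS) uZ.
Qed.

Lemma cut_submodular (Z Y : {set V}) : cut (Z :&: Y) + cut (Z :|: Y) <= cut Z + cut Y.
Proof.
elim: w => //= d p IH; rewrite addnACA [leqRHS]addnACA; apply: leq_add IH.
by rewrite /cross !inE; do 4?[case: (_ \in _)].
Qed.

(** Take [Y] of minimal size among nonempty sets with cut at most 4. A set [Z] separating [Y] has
    cut at least 4. If its cut were 4, then either [Z] and [Y] cover [S] and [S :\: Z] is a smaller
    choice, or [Z :|: Y] has cut at least 4 and submodularity makes [Z :&: Y] a smaller choice. *)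
Lemma tight_set : exists Y : {set V}, [/\ Y != set0, Y \subset S, cut Y <= 4 &
  forall Z : {set V}, Z :&: Y != set0 -> ~~ (Y \subset Z) -> 6 <= cut Z].
Proof.
pose P (Y : {set V}) := [&& Y != set0, Y \subset S & cut Y <= 4].
have PS : P S.
  rewrite /P subxx; apply/and3P; split=> //.
    by apply/set0Pn; exists v0; rewrite in_set mem_head.
  by rewrite (cross_const (c := true) closed_w) // => y yS; rewrite in_set.
have [Y /and3P[Y0 YS cY] minY] := arg_minnP (fun Y : {set V} => #|Y|) PS.
exists Y; split=> // Z /set0Pn[u /setIP[uZ uY]] /subsetPn[u' uY' uZ'].
have uS := subsetP YS u uY; have uS' := subsetP YS u' uY'.
have ge4 := cut_ge4 uS uZ uS' uZ'; have := even_cut Z.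
suff: ~~ (cut Z <= 4) by move: ge4; clear; case: count => [|[|[|[|[|[|k]]]]]].
apply/negP => le4; have [SZY|] := boolP (S \subset Z :|: Y).
  have cD : cut (S :\: Z) = cut Z.
    apply: eq_in_count => d /dart_in_S[sS tS]; rewrite /cross !in_setD sS tS !andbT.
    by case: (_ \in _); case: (_ \in _).
  have DY : S :\: Z \subset Y.
    apply/subsetP => y /setDP[yS yZ]; have := subsetP SZY y yS.
    by rewrite inE (negbTE yZ).
  have : #|Y| <= #|S :\: Z|.
    apply: minY; rewrite /P subsetDl cD le4 !andbT; apply/set0Pn.
    by exists u'; rewrite inE uZ' uS'.
  rewrite leqNgt proper_card // properEneq DY andbT; apply/eqP => E.
  by move: uY; rewrite -E inE uZ.
case/subsetPn=> y yS yZY; have uZY : u \in Z :|: Y by rewrite inE uZ.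
have cU := cut_ge4 uS uZY yS yZY.
have : #|Y| <= #|Z :&: Y|.
  apply: minY; rewrite /P (subset_trans (subsetIr _ _) YS) /=; apply/andP; split.
    by apply/set0Pn; exists u; rewrite inE uZ.
  have := cut_submodular Z Y; move: cU le4 cY; clear.
  by lia.
rewrite leqNgt proper_card // properEneq subsetIr andbT; apply/eqP => E.
by move: uY'; rewrite -E inE (negbTE uZ').
Qed.

(** A negative edge [n] inside [Y] exists by the hypothesis on 4-cuts, or, if no edge leaves [Y],
    because the tour is odd. The rest of the tour is then a single even item, so tails cannot be
    exchanged; balance would leave [n] as the only negative edge, and a split gives two odd
    items. *)
Lemma two_odd_base (Y : {set V}) s : Y != set0 -> Y \subset S -> cut Y <= 4 ->
  two_odd src rv (switch par s) Y w.
Proof.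
move=> /set0Pn[y yY] YS cY; pose pa := switch par s.
have pa_rv : forall d, pa (rv d) = pa d by apply: switch_rv.
have odd_pa : pr pa w by rewrite (pr_switch _ _ closed_w) addbK.
have [n nw [sn tn on]] : exists2 n, n \in w & [/\ src n \in Y, tgt n \in Y & pa n].
  have [c4|c4] := eqVneq (cut Y) 4; first exact: unbalanced_four_cut.
  have c0 : cut Y = 0.
    by have := even_cut Y; have := no_two_cut Y; move: cY c4; case: count => [|[|[|[|[|k]]]]].
  have /hasP[n nw on] : has pa w by rewrite has_count; move: odd_pa; rewrite /pr; case: count.
  exists n => //; have [] := dart_in_S nw; rewrite !in_set => nS nS'.
  have yS : y \in verts v0 w by have := subsetP YS y yY; rewrite in_set.
  by split=> //; rewrite (walk_cross0 closed_w c0) // -(walk_cross0 closed_w c0 yS).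
have [r wr pw] := rotate_closed closed_w nw.
have eqw : eqd (n :: r) w by move=> d; rewrite (cnt_perm _ _ pw).
pose i := (tgt n, src n, r).
have hi : hubbed Y [:: i] by move=> k; rewrite inE => /eqP->.
have ei k : k \in [:: i] -> ~~ pr pa k.2.
  by rewrite inE => /eqP->; move: odd_pa; rewrite -(pr_eqd rvK pa_rv eqw) pr_cons on.
case: (balanced_or_improvable rvK pa_rv hi ei).
- move=> [k [Q0 [c [p1 [p2 [pk cY' [k1 k2] ek [o1 o2]]]]]]].
  have [ki Q00] : k = i /\ Q0 = [::].
    have := perm_size pk; case: Q0 pk => // pk _; split=> //.
    by have := perm_mem pk i; rewrite !inE eqxx => /esym/eqP.
  subst k Q0; exists [:: (src n, tgt n, [:: n]); (i.1.1, c, p1); (c, i.1.2, p2)]; split.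
  + move=> k; rewrite 2!in_cons mem_seq1 => /or3P[] /eqP->; split=> //; exact: walk1.
  + by rewrite /flat /= in ek *; eqd_solve.
  by rewrite /odd_items /= o1 o2 leq_addl.
- move=> [k [k' [Q0 [p [q [pk]]]]]]; by have := perm_size pk.
- move=> [Z [dZ _]]; rewrite /flat /= cats0 => cZ; case/eqP: (no_two_cut Z).
  rewrite -(eqd_count rvK (cross_rv src rvK Z) eqw) /= cZ.
  by rewrite /cross !(disjointFl dZ).
case=> tau tau0 tauE; case/eqP: (not_one (fun y => s y (+) tau y)).
rewrite -(eqd_count rvK (switch_rv src rvK par_rv _) eqw) /=.
rewrite [X in _ + X](_ : _ = 0) ?addn0; last first.
  apply/eqP; rewrite -leqn0 leqNgt -has_count; apply/hasPn => d dQ.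
  have := tauE d; rewrite /flat /= cats0 => /(_ dQ); rewrite /pa /switch -/(tgt d) => h.
  by apply/negP; move: h; case: (par d); case: (s _); case: (s _); case: (tau _); case: (tau _).
rewrite /switch !tau0 // !addbF; move: on; rewrite /pa /switch => ->.
by [].
Qed.

Lemma switch_switch s t d : switch (switch par s) t d = switch par (fun y => s y (+) t y) d.
Proof.
rewrite /switch; case: (par d); case: (s (src d)); case: (s (tgt d));
  by case: (t (src d)); case: (t (tgt d)).
Qed.

(** Induction on the number of vertices of [Y] outside [U]. All switchings [s] are quantified
    because each step first switches at the removed vertex [x] to make the chosen edge [e] even. A
    set that contains [x] and avoids [U] separates [Y], as it misses [v]. *)
Lemma two_odd_grow (Y : {set V}) v : Y != set0 -> Y \subset S -> cut Y <= 4 ->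
  (forall Z : {set V}, Z :&: Y != set0 -> ~~ (Y \subset Z) -> 6 <= cut Z) -> v \in Y ->
  forall s (U : {set V}), v \in U -> U \subset Y -> two_odd src rv (switch par s) U w.
Proof.
move=> Y0 YS cY six vY s U; have [n] := ubnP #|Y :\: U|.
elim: n s U => // n IH s U sn vU UY.
have [YU|YU] := boolP (Y \subset U).
  have -> : U = Y by apply/eqP; rewrite eqEsubset UY.
  exact: two_odd_base.
have [e [ew [eU exY exU]]] : exists e, ((e \in w) || (rv e \in w)) /\
    [/\ src e \in U, tgt e \in Y & tgt e \notin U].
  (* At least six edges leave [U] and at most four leave [Y], so some edge leaves [U] without
     leaving [Y]. *)
  have cU : 6 <= cut U by apply: six => //; apply/set0Pn; exists v; rewrite inE vU.
  have /hasP[d dw /andP[dU dY]] : has (fun d => cross U d && ~~ cross Y d) w.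
    apply: contraTT (leq_ltn_trans cY (ltnW cU)) => /hasPn h; rewrite -leqNgt.
    rewrite (eq_in_count (a2 := predI (cross U) (cross Y))) => [|d /h /=].
      by apply: sub_count => d /andP[].
    by rewrite negb_and negbK; case: (cross U d); case: (cross Y d).
  have UY' := subsetP UY.
  move: dU dY; rewrite /cross.
  have [sU|sU] := boolP (src d \in U); have [tU|tU] := boolP (tgt d \in U) => // _.
    rewrite UY' //; have [tY _|//] := boolP (tgt d \in Y).
    by exists d; rewrite dw; split.
  rewrite (UY' _ tU); have [sY _|//] := boolP (src d \in Y).
  by exists (rv d); rewrite rvK dw orbT tgt_rv //; split.
set x := tgt e in exY exU.
pose s' y := s y (+) ((y == x) && switch par s e).
have ss' : {in U, s' =1 s}.
  by move=> y yU; rewrite /s'; case: eqP yU exU => [->->|]//; rewrite addbF.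
apply: (two_odd_switch ss').
apply: (@two_odd_descent _ _ _ _ rvK _ _ U x exU w _ _ _ _ e eU erefl _ ew) => //.
- by apply: switch_rv.
- exact: even_cut.
- move=> Z xZ dZU; apply: six; first by apply/set0Pn; exists x; rewrite inE xZ.
  by apply/subsetPn; exists v; rewrite ?(disjointFl dZU).
- by move=> t; rewrite (eq_count (switch_switch s' t)).
- rewrite /switch ss' // /s' eqxx /switch -/x.
  by case: (par e); case: (s _); case: (s _).
apply: IH; rewrite ?inE ?vU ?orbT ?subUset ?sub1set ?exY //.
rewrite -ltnS (leq_trans _ sn) // ltnS; apply: proper_card.
apply/properP; split; first by apply: setDS; apply: subsetUr.
by exists x; rewrite !inE ?exU ?exY ?eqxx.
Qed.

Theorem three_odd_closed_walks : exists v T1 T2 T3,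
  [/\ walk v T1 v, walk v T2 v, walk v T3 v, eqd (T1 ++ T2 ++ T3) w &
      [/\ pr par T1, pr par T2 & pr par T3]].
Proof.
have [Y [Y0 YS cY six]] := tight_set; have /set0Pn[v vY] := Y0.
have v1 : v \in [set v] by rewrite inE.
have vsub : [set v] \subset Y by rewrite sub1set.
have [Q [hQ eQ oQ]] := two_odd_grow Y0 YS cY six vY (fun=> false) v1 vsub.
have cl i : i \in Q -> walk v i.2 v.
  by move=> /hQ[]; rewrite !inE /itrail => wi /eqP<- /eqP E; rewrite -{2}E.
have prE i : i \in Q -> pr (switch par (fun=> false)) i.2 = pr par i.2.
  by move=> /cl wi; rewrite (pr_switch _ _ wi) !addbF.
have oQ' : 2 <= odd_items par Q.
  by rewrite (leq_trans oQ) // /odd_items (eq_in_count prE).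
have [i iQ oi] : exists2 i, i \in Q & pr par i.2.
  by apply/hasP; rewrite has_count; apply: leq_trans oQ'.
have pi := perm_to_rem iQ; move: (rem i Q) pi => Q1 pi.
have [j jQ oj] : exists2 j, j \in Q1 & pr par j.2.
  apply/hasP; rewrite has_count; move: oQ'.
  by rewrite /odd_items (permP pi) /= oi.
have pj := perm_to_rem jQ; move: (rem j Q1) pj => Q2 pj.
have pQ : perm_eq Q (i :: j :: Q2) by rewrite (perm_trans pi) // perm_cons.
have sQ2 : {subset Q2 <= Q} by move=> k kQ; rewrite (perm_mem pQ) !inE kQ !orbT.
have E : eqd (i.2 ++ j.2 ++ flat Q2) w.
  apply: eqd_trans eQ => d.
  by rewrite /flat (cnt_flatten_perm _ _ (perm_map snd pQ)).
exists v, i.2, j.2, (flat Q2); split=> //.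
- exact: cl.
- by apply: cl; rewrite (perm_mem pQ) !inE eqxx orbT.
- elim: Q2 sQ2 {pj pQ E} => [|k Q2 IH] sQ2; first exact: eqxx.
  rewrite flat_cons; apply: walk_cat (cl k _) (IH _); first by apply: sQ2; rewrite mem_head.
  by move=> l lQ; apply: sQ2; rewrite inE lQ orbT.
by split=> //; move: odd_w; rewrite -(pr_eqd rvK par_rv E) !pr_cat oi oj /= negbK.
Qed.

End Core.

(** * Flows and reductions at small cuts *)

Section Flows.
Variable V : finType.

(* Source, target, sign ([true] if negative), and flow value leaving the source. *)

Definition fdart : Type := (V * V * bool * int)%type.
Definition fsrc (d : fdart) := d.1.1.1.
Definition fpar (d : fdart) := d.1.2.
Definition fval (d : fdart) := d.2.
(** What leaves one end of a positive edge enters the other end; a negative edge emits the same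
    value at both ends. *)
Definition frv (d : fdart) : fdart :=
  (d.1.1.2, d.1.1.1, d.1.2, if d.1.2 then d.2 else (- d.2)%R).
Definition ftgt (d : fdart) := d.1.1.2.

Lemma frvK : involutive frv.
Proof. by move=> [[[x y] []] f]; rewrite /frv /= ?opprK. Qed.

Lemma fpar_rv d : fpar (frv d) = fpar d. Proof. by []. Qed.

Notation walk := (walk fsrc frv).
Notation rw := (rw frv).
Notation eqd := (eqd frv).
Notation pr := (pr fpar).
Notation switch := (switch fsrc frv fpar).

(* Net outflow, weighted by [g]. *)
Definition wnet (g : V -> int) (p : seq fdart) : int :=
  (\sum_(d <- p) (g (fsrc d) * fval d + g (ftgt d) * fval (frv d)))%R.
(** Indicator functions [g] give conservation at each vertex; arbitrary weights let one equation
    express a whole weighted sum of them. *)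
Definition conserved p := forall g, wnet g p = 0%R.
Definition val_lt3 p := all (fun d => 0 < `|fval d| < 3)%N p.

Lemma wnet_cat g p q : wnet g (p ++ q) = (wnet g p + wnet g q)%R.
Proof. by rewrite /wnet big_cat. Qed.

Lemma wnet_cons g d p : wnet g (d :: p) =
  (g (fsrc d) * fval d + g (ftgt d) * fval (frv d) + wnet g p)%R.
Proof. by rewrite /wnet big_cons. Qed.

Lemma wnet_nil g : wnet g [::] = 0%R.
Proof. by rewrite /wnet big_nil. Qed.

Lemma wnet_rw g p : wnet g (rw p) = wnet g p.
Proof.
elim: p => // d p IH; rewrite rw_cons wnet_cat IH !wnet_cons wnet_nil addr0 addrC.
by rewrite -/(frv (frv d)) frvK [X in (X + _)%R]addrC.
Qed.

Lemma val_lt3_rv d : (0 < `|fval (frv d)| < 3)%N = (0 < `|fval d| < 3)%N.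
Proof. by case: d => [[[x y] []] f]; rewrite /fval /frv //= abszN. Qed.

Lemma val_lt3_eqd p q : eqd p q -> val_lt3 p -> val_lt3 q.
Proof.
by move=> E; rewrite /val_lt3 !all_count (eqd_count frvK val_lt3_rv E) (eqd_size frvK E).
Qed.

Definition three_odd w := exists v T1 T2 T3,
  [/\ walk v T1 v, walk v T2 v, walk v T3 v, eqd (T1 ++ T2 ++ T3) w &
      [/\ pr T1, pr T2 & pr T3]].

Lemma three_odd_eqd p q : eqd p q -> three_odd p -> three_odd q.
Proof.
move=> E [v [T1 [T2 [T3 [h1 h2 h3 h4 h5]]]]]; exists v, T1, T2, T3; split=> //.
exact: eqd_trans E.
Qed.

(** The last clause says that [e] has been exchanged for [t], written without subtraction. *)
Lemma expand_edge v T e t : walk v T v -> (e \in T) || (frv e \in T) ->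
  walk (fsrc e) t (ftgt e) -> pr t = fpar e ->
  exists T', [/\ walk v T' v, pr T' = pr T & eqd (T' ++ [:: e]) (T ++ t)].
Proof.
move=> wT eT wt pt.
have rK := frvK.
case/orP: eT wT => /splitPr[p1 p2] /walk_catE[c w1 /andP[/eqP sc w2]].
  exists (p1 ++ t ++ p2); split.
  - by apply: walk_cat w1 _; rewrite -sc; apply: walk_cat wt w2.
  - by rewrite !pr_cat pr_cons pt.
  by eqd_solve.
exists (p1 ++ rw t ++ p2); split.
- apply: walk_cat w1 _; apply: walk_cat w2; rewrite -sc.
  by apply: walk_rw wt; exact: frvK.
- by rewrite !pr_cat pr_cons pr_rw ?pt.
by eqd_solve.
Qed.

Lemma three_odd_expand e t p : walk (fsrc e) t (ftgt e) -> pr t = fpar e ->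
  three_odd (e :: p) -> three_odd (t ++ p).
Proof.
move=> wt pt [v [T1 [T2 [T3 [w1 w2 w3 E [o1 o2 o3]]]]]].
have rK := frvK.
have : (e \in T1 ++ T2 ++ T3) || (frv e \in T1 ++ T2 ++ T3).
  by apply: eqd_mem (eqd_sym E) _; rewrite mem_head.
rewrite !mem_cat.
have [eT1 _|n1] := boolP ((e \in T1) || (frv e \in T1)).
  have [T' [w' p' E']] := expand_edge w1 eT1 wt pt.
  by exists v, T', T2, T3; split; rewrite ?p' //; eqd_solve.
have [eT2 _|n2] := boolP ((e \in T2) || (frv e \in T2)).
  have [T' [w' p' E']] := expand_edge w2 eT2 wt pt.
  by exists v, T1, T', T3; split; rewrite ?p' //; eqd_solve.
move=> h; have eT3 : (e \in T3) || (frv e \in T3).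
  move: n1 n2 h; case: (e \in T1); case: (e \in T2) => //=.
  by case: (frv e \in T1); case: (frv e \in T2).
have [T' [w' p' E']] := expand_edge w3 eT3 wt pt.
by exists v, T1, T2, T'; split; rewrite ?p' //; eqd_solve.
Qed.

Lemma wnet_balanced s p : count (switch s) p = 0 -> wnet (fun y => (-1) ^+ s y)%R p = 0%R.
Proof.
elim: p => [|x p IH] /=; first by rewrite wnet_nil.
case sx: (switch s x) => //= /IH h; rewrite wnet_cons h addr0.
move: sx; rewrite /switch /fpar -/(ftgt x); case: x => [[[a b] c] f] /=.
rewrite /fsrc /ftgt /fval /frv /tgt /=; clear.
by case: c; case: (s a); case: (s b) => //= _; rewrite !(expr0, expr1); lia.
Qed.

(** With weights [(-1) ^+ s], edges that are positive after switching contribute 0 and a negative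
    one contributes twice its value up to sign, so a single one could not be cancelled. *)
Lemma not_one_odd w s : val_lt3 w -> conserved w -> count (switch s) w != 1.
Proof.
move=> sw /(_ (fun y => (-1) ^+ s y)%R) cw; apply/eqP => c1.
have [|p [d [q [E cp od cq]]]] := @split_first _ (switch s) w; first by rewrite c1.
move: cq cw sw; rewrite c1 E wnet_cat wnet_cons => -[/esym cq].
rewrite !wnet_balanced // add0r addr0 /val_lt3 all_cat /= => h /and3P[_ sd _].
move: od h sd; rewrite /switch /fpar; case: (d) => [[[a b] c] f] /=.
rewrite /fsrc /ftgt /fval /frv /tgt /=; clear.
by case: c; case: (s a); case: (s b) => //= _; rewrite !(expr0, expr1); lia.
Qed.

End Flows.

(** * Replacing one side of a cut with two or four edges *)

Section Reductions.
Variable V : finType.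
Notation D := (fdart V).
Notation fsrc := (@fsrc V).
Notation frv := (@frv V).
Notation fpar := (@fpar V).
Notation fval := (@fval V).
Notation tgt := (tgt fsrc frv).
Notation walk := (walk fsrc frv).
Notation verts := (verts fsrc frv).
Notation rw := (rw frv).
Notation eqd := (eqd frv).
Notation cross := (cross fsrc frv).
Notation pr := (pr fpar).
Notation switch := (switch fsrc frv fpar).
Let rK := @frvK V.
Let rpar := @fpar_rv V.

Lemma wnet_ext (g h : V -> int) a p b : walk a p b ->
  {in verts a p, g =1 h} -> wnet g p = wnet h p.
Proof.
elim: p a => [|d p IH] a /=; first by rewrite !wnet_nil.
case/andP=> /eqP sd w gh; rewrite !wnet_cons (IH _ w) => [|y yp]; last first.
  by apply: gh; rewrite inE yp orbT.
by rewrite sd !gh ?inE ?eqxx ?orbT.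
Qed.

Lemma wnet0 (p : seq D) : wnet (fun=> 0%R) p = 0%R.
Proof. by elim: p => [|d p IH]; rewrite ?wnet_nil // wnet_cons IH !mul0r. Qed.

Lemma wnet1_even (p : seq D) : exists k, wnet (fun=> 1%R) p = (k + k)%R.
Proof.
elim: p => [|d p [k IH]]; first by exists 0%R; rewrite wnet_nil.
rewrite wnet_cons IH !mul1r /frv /fval /=; case: d.1.2.
  by exists (d.2 + k)%R; lia.
by exists k; lia.
Qed.

Lemma wnet_eqd g p q : eqd p q -> wnet g p = wnet g q.
Proof.
move=> E; have W u : (wnet g u + wnet g u = \sum_(d <- u ++ map frv u)
    (g (fsrc d) * fval d + g (ftgt d) * fval (frv d)))%R.
  by rewrite big_cat -/(wnet g u) big_map; congr (_ + _)%R; rewrite -[LHS](wnet_rw g u)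
    /wnet /rw (perm_big _ (permEl (perm_rev _))) big_map.
have P : perm_eq (p ++ map frv p) (q ++ map frv q).
  have cm u d : count_mem d (u ++ map frv u) = cnt frv d u.
    rewrite count_cat count_map; congr addn; apply: eq_count => x /=.
    by rewrite (can2_eq rK rK).
  by apply/allP => d _ /=; rewrite !cm E.
by have := W p; rewrite (perm_big _ P) -W; lia.
Qed.

Lemma conserved_eqd p q : eqd p q -> conserved p -> conserved q.
Proof. by move=> E c g; rewrite -(wnet_eqd g E). Qed.

Variable n : nat.
Hypothesis IH : forall v w, size w < n -> walk v w v -> val_lt3 w -> conserved w ->
  pr w -> three_odd w.

(* Weights vanishing on [Z] transfer conservation to a graph in which [Z] has
   been replaced by edges. *)
Definition zero_on (Z : {set V}) (g : V -> int) y := if y \in Z then 0%R else g y.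

Lemma zero_on_outside (Z : {set V}) g a p b : walk a p b -> {in verts a p, forall y, y \notin Z} ->
  wnet (zero_on Z g) p = wnet g p.
Proof. by move=> w h; apply: wnet_ext w _ => y /h; rewrite /zero_on => /negbTE->. Qed.

Lemma zero_on_inside (Z : {set V}) g a p b : walk a p b -> {in verts a p, forall y, y \in Z} ->
  wnet (zero_on Z g) p = 0%R.
Proof. by move=> w h; rewrite -[RHS](wnet0 p); apply: wnet_ext w _ => y /h; rewrite /zero_on => ->. Qed.

Section TwoCut.
Variables (Z : {set V}) (c1 c2 : D) (P O : seq D).
Let w := c1 :: P ++ c2 :: O.
Hypotheses (sw : val_lt3 w) (cw : conserved w) (size_w : size w <= n).
Hypotheses (wP : walk (tgt c1) P (fsrc c2)) (wO : walk (tgt c2) O (fsrc c1)).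
Hypotheses (inP : {in verts (tgt c1) P, forall y, y \in Z})
  (outO : {in verts (tgt c2) O, forall y, y \notin Z}).

(* Conservation outside [Z]: each negative edge there contributes an even
   amount, so the values on the two cut edges have the same parity. *)
Lemma two_cut_values :
  (fval (frv c2) = fval c1 \/ fval (frv c2) = - fval c1)%R.
Proof.
have := cw (zero_on Z (fun=> 1%R)); rewrite wnet_cons wnet_cat wnet_cons.
rewrite (zero_on_inside _ wP inP) (zero_on_outside _ wO outO); have [k ->] := wnet1_even O.
rewrite /zero_on -!/(tgt _) (negbTE (outO (verts_end wO))) (inP (mem_head _ _)).
rewrite (inP (verts_end wP)) (negbTE (outO (mem_head _ _))).
have /allP sw' := sw; have s1 := sw' c1 (mem_head _ _).
have s2 : 0 < `|fval (frv c2)| < 3.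
  by rewrite val_lt3_rv; apply: sw'; rewrite in_cons mem_cat mem_head !orbT.
move: s1 s2; move: (fval (frv c2)) (fval c1) => x y; clear.
by rewrite !(mul1r, mul0r); lia.
Qed.

(** The side [Z] becomes the edge [e], which is negative exactly when both cut edges carry the same
    value out of their ends outside [Z]. The hypothesis says that the smaller graph is odd; with
    [pr w] it forces the replaced walk to have the parity of [e]. *)
Lemma two_cut_reduce : pr w ->
  (fval c1 == fval (frv c2)) (+) pr O -> three_odd w.
Proof.
move=> ow oO; pose s := fval c1 == fval (frv c2).
pose e : D := (fsrc c1, tgt c2, s, fval c1).
have we : val_lt3 [:: e].
  by move: sw; rewrite /val_lt3 /= andbT => /andP[].
have ee : fval (frv e) = fval (frv c2).
  rewrite [LHS](_ : _ = if s then fval c1 else (- fval c1)%R) // /s.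
  by case: eqP => // ne; case: two_cut_values => // E; case: ne.
have red : three_odd (e :: O).
  apply: (IH (v := fsrc c1)).
  - by apply: leq_trans size_w; rewrite /w /= size_cat /= addnS !ltnS leq_addl.
  - by rewrite /= eqxx.
  - by move: sw we; rewrite /val_lt3 /= all_cat /= andbT => /and4P[_ _ _ ->] ->.
  - move=> g; rewrite -(cw (zero_on Z g)) !wnet_cons wnet_cat wnet_cons.
    rewrite (zero_on_inside _ wP inP) (zero_on_outside _ wO outO) ee.
    rewrite /zero_on -!/(tgt _) (negbTE (outO (verts_end wO))) (inP (mem_head _ _)).
    rewrite (inP (verts_end wP)) (negbTE (outO (mem_head _ _))).
    by rewrite !mul0r !addr0 !add0r addrA.
  by rewrite pr_cons.
apply: three_odd_eqd (three_odd_expand (t := c1 :: P ++ [:: c2]) _ _ red).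
- by rewrite /w /= -catA.
- rewrite /= eqxx /=; apply: walk_cat wP _; by rewrite /= !eqxx.
have -> : fpar e = s by [].
move: ow oO; rewrite /w -/s !(pr_cons, pr_cat); move: (s) => b.
by case: b; case: (fpar c1); case: (fpar c2); case: (pr P); case: (pr O).
Qed.

End TwoCut.

Lemma two_cut_three_odd v w (Z : {set V}) : size w <= n -> walk v w v -> val_lt3 w ->
  conserved w -> pr w -> count (cross Z) w = 2 -> three_odd w.
Proof.
move=> sz wv sw cw ow c2; have [|c1 [p [wp sc1 tc1 pp]]] := closed_enter (Z := Z) wv.
  by rewrite c2.
have ep : eqd (c1 :: p) w by move=> d; rewrite (cnt_perm _ _ pp).
have cp : count (cross Z) p = 1.
  by move: c2; rewrite -(eqd_count rK (cross_rv fsrc rK Z) ep) /= {1}/cross (negbTE sc1) tc1 => -[].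
have [P [d [O [Ep [wP wO] PZ td O0]]]] := walk_exit wp tc1 cp.
have OZ : {in verts (tgt d) O, forall y, y \notin Z}.
  by move=> y yO; rewrite (walk_cross0 wO O0 yO).
rewrite Ep in ep; have es := eqd_sym ep.
have sw1 := val_lt3_eqd es sw; have cw1 := conserved_eqd es cw.
have sz1 : size (c1 :: P ++ d :: O) <= n by rewrite (eqd_size rK ep).
have ow1 : pr (c1 :: P ++ d :: O) by rewrite (pr_eqd rK rpar ep).
apply: three_odd_eqd ep _.
have [o1|o1] := boolP ((fval c1 == fval (frv d)) (+) pr O).
  exact: (two_cut_reduce sw1 cw1 sz1 wP wO PZ OZ).
(* Replacing the other side works now: as the whole walk is odd, exactly one of the two smaller
   graphs is odd. *)
have e2 : eqd (d :: O ++ c1 :: P) (c1 :: P ++ d :: O).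
  by move=> x; rewrite -cat_cons [RHS](cnt_perm _ _ (permEl (perm_catC (c1 :: P) (d :: O)))).
have e2s := eqd_sym e2; apply: three_odd_eqd e2 _.
have PZ' : {in verts (tgt c1) P, forall y, y \notin ~: Z}.
  by move=> y /PZ; rewrite in_setC negbK.
have OZ' : {in verts (tgt d) O, forall y, y \in ~: Z}.
  by move=> y /OZ; rewrite in_setC.
apply: (two_cut_reduce (val_lt3_eqd e2s sw1) (conserved_eqd e2s cw1) _ wO wP OZ' PZ').
- by rewrite -(eqd_size rK e2s).
- by rewrite -(pr_eqd rK rpar e2s).
have v1 := two_cut_values sw1 cw1 wP wO PZ OZ.
have c0 : fval c1 != 0%R.
  by move/allP: sw1 => /(_ c1 (mem_head _ _)); case: (fval c1) => [[]|].
move: c0 v1 ow1 o1; rewrite !(pr_cons, pr_cat) /fpar /fval /frv /=.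
move: (d.2) (c1.2) (d.1.2) (c1.1.2) (pr P) (pr O); clear => x y a b p q y0 v1.
have n1 : (y == - y)%R = false by apply/eqP; move: y0; clear; lia.
have n2 : (- y == y)%R = false by rewrite eq_sym.
have E : (x = y \/ x = - y)%R by clear -v1; case: a v1 => -[]; lia.
by case: E => ->; case: a {v1}; case: b; case: p; case: q => //=; rewrite ?opprK ?eqxx ?n1 ?n2.
Qed.

Section FourCut.
Variables (Z : {set V}) (s : V -> bool).
(* The value on a dart entering [Z], after the switching that makes all edges
   inside [Z] positive. *)
Definition entering c : int := ((-1) ^+ s (tgt c) * fval (frv c))%R.
Definition balanced (p : seq D) := count (switch s) p = 0.
Definition passage c P d := [/\ walk (tgt c) P (fsrc d),
  {in verts (tgt c) P, forall y, y \in Z} & balanced P].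
Definition detour d O c := walk (tgt d) O (fsrc c) /\
  {in verts (tgt d) O, forall y, y \notin Z}.

Definition shortcut c P d : D := (fsrc c, tgt d, pr (c :: P ++ [:: d]), fval c).

(** Inside [Z] all edges are positive after switching, so the parity of the passage is determined by
    [s] at its ends. Hence cancelling entering values agree with the sign of the new edge. *)
Lemma shortcut_value c P d : passage c P d -> (entering c + entering (frv d))%R = 0%R ->
  fval (frv (shortcut c P d)) = fval (frv d).
Proof.
case=> [wP _ bP]; rewrite /entering (tgt_rv _ rK) rK.
have : pr P = s (tgt c) (+) s (fsrc d).
  have := pr_switch fpar s wP; rewrite [LHS](congr1 odd bP) /=.
  by case: (pr P); case: (s _); case: (s _).
rewrite /shortcut pr_cons pr_cat pr_cons => ->.
rewrite /frv /fval /fpar /=; move: (s _) (s _) (c.1.2) (d.1.2) (c.2) (d.2); clear.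
by move=> a b a' b' x y; case: a; case: b; case: a'; case: b';
  rewrite /= ?expr0 ?expr1; lia.
Qed.

Lemma wnet_passage g c P d : passage c P d -> fsrc c \notin Z -> tgt d \notin Z ->
  wnet (zero_on Z g) (c :: P ++ [:: d]) = (g (fsrc c) * fval c + g (tgt d) * fval (frv d))%R.
Proof.
case=> [wP inP _] sc td; rewrite wnet_cons wnet_cat wnet_cons (zero_on_inside _ wP inP).
rewrite wnet_nil /zero_on -!/(tgt _) (negbTE sc) (negbTE td) (inP _ (mem_head _ _)).
by rewrite (inP _ (verts_end wP)) !mul0r !addr0 !add0r.
Qed.

Lemma four_cut_paired c1 P c2 O1 c3 Q c4 O2 :
  let w := c1 :: P ++ c2 :: O1 ++ c3 :: Q ++ c4 :: O2 in
  size w <= n -> val_lt3 w -> conserved w -> pr w ->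
  passage c1 P c2 -> detour c2 O1 c3 -> passage c3 Q c4 -> detour c4 O2 c1 ->
  (entering c1 + entering (frv c2))%R = 0%R ->
  (entering c3 + entering (frv c4))%R = 0%R -> three_odd w.
Proof.
move=> w sz sw cw ow p1 [wO1 oO1] p2 [wO2 oO2] v12 v34.
set e := shortcut c1 P c2; set f := shortcut c3 Q c4.
have Ew : w = (c1 :: P ++ [:: c2]) ++ O1 ++ (c3 :: Q ++ [:: c4]) ++ O2.
  by rewrite /w /= -!catA.
have swf : val_lt3 (e :: O1 ++ f :: O2).
  move: sw; rewrite Ew /val_lt3 /= !all_cat /= !all_cat /=.
  by move=> /andP[-> /andP[_ /andP[-> /andP[-> /andP[_ ->]]]]].
have red : three_odd (e :: O1 ++ f :: O2).
  apply: (IH (v := fsrc c1)) => //.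
  - apply: leq_trans sz; rewrite /w /= !size_cat /= !size_cat /= !addnS !ltnS.
    by rewrite size_cat /=; move: (size P) (size Q) (size O1) (size O2); clear; lia.
  - by rewrite /= eqxx; apply: walk_cat wO1 _; rewrite /= eqxx.
  - move=> g; rewrite -(cw (zero_on Z g)) Ew 3!wnet_cat !wnet_passage //; last first.
    + by apply: oO1; rewrite mem_head.
    + exact: oO2 (verts_end wO2).
    + by apply: oO2; rewrite mem_head.
    + exact: oO1 (verts_end wO1).
    rewrite (zero_on_outside _ wO1 oO1) (zero_on_outside _ wO2 oO2) wnet_cons wnet_cat wnet_cons.
    by rewrite !shortcut_value // !addrA.
  by rewrite (pr_cons _ e) pr_cat (pr_cons _ f); move: ow; rewrite Ew 3!pr_cat.
have walk_passage c R d : passage c R d -> walk (fsrc c) (c :: R ++ [:: d]) (tgt d).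
  by case=> wR _ _; rewrite /= eqxx; apply: walk_cat wR _; rewrite /= !eqxx.
have := three_odd_expand (e := e) (walk_passage _ _ _ p1) erefl red.
have E1 : eqd ((c1 :: P ++ [:: c2]) ++ O1 ++ f :: O2) (f :: ((c1 :: P ++ [:: c2]) ++ O1) ++ O2).
  move=> d; rewrite catA; apply: cnt_perm.
  exact: (permEl (perm_catCA _ [:: f] O2)).
move=> r; have := three_odd_expand (e := f) (walk_passage _ _ _ p2) erefl (three_odd_eqd E1 r).
apply: three_odd_eqd => d; rewrite Ew; apply: cnt_perm.
by rewrite perm_catCA -[(_ ++ O1) ++ _]catA.
Qed.

Lemma balanced_eqd p q : eqd p q -> balanced p -> balanced q.
Proof. by rewrite /balanced => /(eqd_count rK (switch_rv fsrc rK rpar s))->. Qed.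

Lemma balanced_cat p q : balanced (p ++ q) <-> balanced p /\ balanced q.
Proof.
rewrite /balanced count_cat; split=> [/eqP|[-> ->]] //.
by rewrite addn_eq0 => /andP[/eqP-> /eqP->].
Qed.

(** At a common vertex the four half-passages can be joined in both other ways, which re-pairs the
    cut edges. *)
Lemma passage_swap c1 P c2 c3 Q c4 z : passage c1 P c2 -> passage c3 Q c4 ->
  z \in verts (tgt c1) P -> z \in verts (tgt c3) Q ->
  exists P1 P2 Q1 Q2, [/\ P = P1 ++ P2, Q = Q1 ++ Q2,
    passage c1 (P1 ++ Q2) c4 /\ passage c3 (Q1 ++ P2) c2 &
    passage c1 (P1 ++ rw Q1) (frv c3) /\ passage (frv c2) (rw P2 ++ Q2) c4].
Proof.
move=> [wP iP bP] [wQ iQ bQ] /(vertsP wP)[P1 [P2 [EP p1 p2]]] /(vertsP wQ)[Q1 [Q2 [EQ q1 q2]]].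
exists P1, P2, Q1, Q2.
move: bP bQ iP iQ; rewrite EP EQ => /balanced_cat[b1 b2] /balanced_cat[b3 b4] iP iQ.
have bR p : balanced p -> balanced (rw p).
  by apply: balanced_eqd => d; rewrite cnt_rw.
have i1 y : y \in verts (tgt c1) P1 -> y \in Z.
  by move=> h; apply: iP; rewrite (verts_cat _ _ p1) h.
have i2 y : y \in verts z P2 -> y \in Z.
  by move=> h; apply: iP; rewrite (verts_cat _ _ p1) h orbT.
have i3 y : y \in verts (tgt c3) Q1 -> y \in Z.
  by move=> h; apply: iQ; rewrite (verts_cat _ _ q1) h.
have i4 y : y \in verts z Q2 -> y \in Z.
  by move=> h; apply: iQ; rewrite (verts_cat _ _ q1) h orbT.
have r1 := walk_rw rK q1; have r2 := walk_rw rK p2.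
split=> //; split; split.
- exact: walk_cat p1 q2.
- by move=> y; rewrite (verts_cat _ _ p1) => /orP[/i1|/i4].
- by apply/balanced_cat.
- exact: walk_cat q1 p2.
- by move=> y; rewrite (verts_cat _ _ q1) => /orP[/i3|/i2].
- by apply/balanced_cat.
- by apply: walk_cat p1 r1.
- by move=> y; rewrite (verts_cat _ _ p1) (verts_rw rK q1) => /orP[/i1|/i3].
- by apply/balanced_cat; split=> //; apply: bR.
- by rewrite (tgt_rv _ rK); apply: walk_cat r2 q2.
- by move=> y; rewrite (tgt_rv _ rK) (verts_cat _ _ r2) (verts_rw rK p2) => /orP[/i2|/i4].
by apply/balanced_cat; split=> //; apply: bR.
Qed.

Lemma detour_swap c2 O1 c3 c4 O2 c1 z : detour c2 O1 c3 -> detour c4 O2 c1 ->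
  z \in verts (tgt c2) O1 -> z \in verts (tgt c4) O2 ->
  exists A1 A2 B1 B2, [/\ O1 = A1 ++ A2, O2 = B1 ++ B2,
    detour c4 (B1 ++ A2) c3 & detour c2 (A1 ++ B2) c1].
Proof.
move=> [wA oA] [wB oB] /(vertsP wA)[A1 [A2 [EA a1 a2]]] /(vertsP wB)[B1 [B2 [EB b1 b2]]].
exists A1, A2, B1, B2; move: oA oB; rewrite EA EB => oA oB.
split=> //; split.
- exact: walk_cat b1 a2.
- move=> y; rewrite (verts_cat _ _ b1) => /orP[h|h].
    by apply: oB; rewrite (verts_cat _ _ b1) h.
  by apply: oA; rewrite (verts_cat _ _ a1) h orbT.
- exact: walk_cat a1 b2.
move=> y; rewrite (verts_cat _ _ a1) => /orP[h|h].
  by apply: oA; rewrite (verts_cat _ _ a1) h.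
by apply: oB; rewrite (verts_cat _ _ b1) h orbT.
Qed.

Lemma detour_rw c2 O1 c3 : detour c2 O1 c3 -> detour (frv c3) (rw O1) (frv c2).
Proof.
case=> w o; rewrite /detour (tgt_rv _ rK); split; first exact: walk_rw rK _ _ _ w.
by move=> y; rewrite (verts_rw rK w) => /o.
Qed.

(** This depends on the bound 3: the values 1, 1, 1, -3 cannot be paired. *)
Lemma pairing_cases (a b c d : int) :
  (0 < `|a| < 3)%N -> (0 < `|b| < 3)%N -> (0 < `|c| < 3)%N -> (0 < `|d| < 3)%N ->
  (a + b + (c + d) = 0)%R ->
  [\/ (a + b = 0 /\ c + d = 0)%R, (a + c = 0 /\ b + d = 0)%R | (a + d = 0 /\ c + b = 0)%R].
Proof.
move=> ha hb hc hd h.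
have [e1|n1] := eqVneq (a + b)%R 0%R; first by apply: Or31; lia.
have [e2|n2] := eqVneq (a + c)%R 0%R; first by apply: Or32; lia.
by apply: Or33; lia.
Qed.

Lemma val_lt3_entering c : (0 < `|fval c| < 3)%N -> (0 < `|entering c| < 3)%N.
Proof. by rewrite -val_lt3_rv /entering abszMsign. Qed.

Lemma four_cut_passages c1 P c2 O1 c3 Q c4 O2 :
  let w := c1 :: P ++ c2 :: O1 ++ c3 :: Q ++ c4 :: O2 in
  size w <= n -> val_lt3 w -> conserved w -> pr w ->
  (forall A : {set V}, count (cross A) w != 2) ->
  passage c1 P c2 -> detour c2 O1 c3 -> passage c3 Q c4 -> detour c4 O2 c1 ->
  three_odd w.
Proof.
move=> w sz sw cw ow no2 p1 d1 p2 d2.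
have [wP iP bP] := p1; have [wQ iQ bQ] := p2; have [wO1 oO1] := d1; have [wO2 oO2] := d2.
have sc1 := oO2 _ (verts_end wO2); have tc1 := iP _ (mem_head _ _).
have sc2 := iP _ (verts_end wP); have tc2 := oO1 _ (mem_head _ _).
have sc3 := oO1 _ (verts_end wO1); have tc3 := iQ _ (mem_head _ _).
have sc4 := iQ _ (verts_end wQ); have tc4 := oO2 _ (mem_head _ _).
have avoid (A : {set V}) a p b : walk a p b -> {in verts a p, forall y, y \notin A} ->
    count (cross A) p = 0.
  by move=> wp h; apply: (cross_const (c := false) wp) => y /h/negbTE.
(* Without a common vertex, only [c1] and [c2] would leave the vertex set of [P]. *)
have [z zP zQ] : exists2 z, z \in verts (tgt c1) P & z \in verts (tgt c3) Q.
  apply/hasP; apply: contraT => /hasPn h; case/eqP: (no2 [set y in verts (tgt c1) P]).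
  set A := [set y in verts (tgt c1) P].
  have nZ y : y \notin Z -> y \notin A by apply: contra; rewrite in_set => /iP.
  have nQ y : y \in verts (tgt c3) Q -> y \notin A.
    by move=> yQ; rewrite in_set; apply: contraL yQ => /h.
  rewrite /w /= !count_cat /= !count_cat /= !count_cat /=.
  rewrite (cross_const (c := true) wP) => [|y yP]; last first.
    by rewrite in_set yP.
  rewrite (avoid A _ _ _ wO1) => [|y /oO1/nZ//]; rewrite (avoid A _ _ _ wQ) //.
  rewrite (avoid A _ _ _ wO2) => [|y /oO2/nZ//].
  rewrite /cross (negbTE (nZ _ sc1)) (negbTE (nZ _ tc2)) (negbTE (nZ _ sc3)) (negbTE (nZ _ tc4)).
  rewrite (negbTE (nQ _ (mem_head _ _))) (negbTE (nQ _ (verts_end wQ))).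
  by rewrite !in_set -!/(verts _ _) (verts_end wP) mem_head.
have [z' zO1 zO2] : exists2 z', z' \in verts (tgt c2) O1 & z' \in verts (tgt c4) O2.
  apply/hasP; apply: contraT => /hasPn h; case/eqP: (no2 [set y in verts (tgt c2) O1]).
  set A := [set y in verts (tgt c2) O1].
  have nZ y : y \in Z -> y \notin A by rewrite in_set => yZ; apply: contraL yZ => /oO1.
  have nQ y : y \in verts (tgt c4) O2 -> y \notin A.
    by move=> yQ; rewrite in_set; apply: contraL yQ => /h.
  rewrite /w /= !count_cat /= !count_cat /= !count_cat /=.
  rewrite (cross_const (c := true) wO1) => [|y yP]; last first.
    by rewrite in_set yP.
  rewrite (avoid A _ _ _ wP) => [|y /iP/nZ//]; rewrite (avoid A _ _ _ wO2) //.
  rewrite (avoid A _ _ _ wQ) => [|y /iQ/nZ//].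
  rewrite /cross (negbTE (nZ _ tc1)) (negbTE (nZ _ sc2)) (negbTE (nZ _ tc3)) (negbTE (nZ _ sc4)).
  rewrite (negbTE (nQ _ (mem_head _ _))) (negbTE (nQ _ (verts_end wO2))).
  by rewrite !in_set -!/(verts _ _) (verts_end wO1) mem_head.
have Ew : w = (c1 :: P ++ [:: c2]) ++ O1 ++ (c3 :: Q ++ [:: c4]) ++ O2.
  by rewrite /w /= -!catA.
(* Conservation over [Z] after switching: the positive edges inside cancel, leaving the four cut
   edges. *)
have s0 : (entering c1 + entering (frv c2) + (entering c3 + entering (frv c4)) = 0)%R.
  have g0 y : y \notin Z -> zero_on (~: Z) (fun y => (-1) ^+ s y)%R y = 0%R.
    by rewrite /zero_on in_setC => ->.
  have g1 y : y \in Z -> zero_on (~: Z) (fun y => (-1) ^+ s y)%R y = ((-1) ^+ s y)%R.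
    by rewrite /zero_on in_setC => ->.
  have inC a p b : walk a p b -> {in verts a p, forall y, y \in Z} -> balanced p ->
      wnet (zero_on (~: Z) (fun y => (-1) ^+ s y)%R) p = 0%R.
    move=> wp ip bp; rewrite (zero_on_outside _ wp) => [|y /ip]; first exact: wnet_balanced.
    by rewrite in_setC negbK.
  have outC a p b : walk a p b -> {in verts a p, forall y, y \notin Z} ->
      wnet (zero_on (~: Z) (fun y => (-1) ^+ s y)%R) p = 0%R.
    by move=> wp ip; apply: (zero_on_inside _ wp) => y /ip; rewrite in_setC.
  have := cw (zero_on (~: Z) (fun y => (-1) ^+ s y)%R).
  rewrite Ew 3!wnet_cat !wnet_cons !wnet_cat !wnet_cons wnet_nil.
  rewrite (inC _ _ _ wP iP bP) (inC _ _ _ wQ iQ bQ) (outC _ _ _ wO1 oO1) (outC _ _ _ wO2 oO2).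
  rewrite (g0 _ sc1) (g1 _ tc1) (g1 _ sc2) (g0 _ tc2) (g0 _ sc3) (g1 _ tc3) (g1 _ sc4) (g0 _ tc4).
  rewrite /entering !(tgt_rv _ rK) !rK.
  by rewrite !mul0r !addr0 !add0r.
have /allP sw' := sw.
have in1 : c1 \in w by rewrite mem_head.
have in2 : c2 \in w by rewrite Ew !(mem_cat, in_cons) eqxx ?orbT.
have in3 : c3 \in w by rewrite Ew !(mem_cat, in_cons) eqxx ?orbT.
have in4 : c4 \in w by rewrite Ew !(mem_cat, in_cons) eqxx ?orbT.
have e1 := val_lt3_entering (sw' _ in1).
have e2 : 0 < `|entering (frv c2)| < 3 by apply: val_lt3_entering; rewrite val_lt3_rv; apply: sw'.
have e3 := val_lt3_entering (sw' _ in3).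
have e4 : 0 < `|entering (frv c4)| < 3 by apply: val_lt3_entering; rewrite val_lt3_rv; apply: sw'.
have rr := frvK (V := V).
have [P1 [P2 [Q1 [Q2 [EP EQ [q1 q2] [q3 q4]]]]]] := passage_swap p1 p2 zP zQ.
have [A1 [A2 [B1 [B2 [EA EB d3 d4]]]]] := detour_swap d1 d2 zO1 zO2.
have transfer w' : eqd w' w -> (size w' <= n -> val_lt3 w' -> conserved w' -> pr w' ->
    three_odd w') -> three_odd w.
  move=> E h; apply: (three_odd_eqd E); have Es := eqd_sym E.
  apply: h; rewrite ?(eqd_size rK E) //; first exact: val_lt3_eqd Es sw.
    exact: conserved_eqd Es cw.
  by rewrite (pr_eqd rK rpar E).
(* The walk is rearranged so that each passage joins two cancelling cut edges. The second pairing
   reverses a detour; the third also rejoins the detours, at [z'], to keep a single closed walk. *)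
case: (pairing_cases e1 e2 e3 e4 s0) => -[x1 x2].
- exact: four_cut_paired.
- apply: (transfer (c1 :: (P1 ++ rw Q1) ++ frv c3 :: rw O1 ++ frv c2 :: (rw P2 ++ Q2) ++ c4 :: O2)).
    by rewrite /w EP EQ; eqd_solve.
  move=> h1 h2 h3 h4; apply: four_cut_paired => //; first exact: detour_rw.
  by rewrite rK.
apply: (transfer (c1 :: (P1 ++ Q2) ++ c4 :: (B1 ++ A2) ++ c3 :: (Q1 ++ P2) ++ c2 :: (A1 ++ B2))).
  by rewrite /w EP EQ EA EB; eqd_solve.
by move=> h1 h2 h3 h4; apply: four_cut_paired.
Qed.

Lemma four_cut_three_odd v w : size w <= n -> walk v w v -> val_lt3 w -> conserved w ->
  pr w -> (forall A : {set V}, count (cross A) w != 2) -> count (cross Z) w = 4 ->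
  (forall d, d \in w -> fsrc d \in Z -> tgt d \in Z -> ~~ switch s d) -> three_odd w.
Proof.
move=> sz wv sw cw ow no2 c4 bal.
have [|c1 [p [wp sc1 tc1 pp]]] := closed_enter (Z := Z) wv; first by rewrite c4.
have ep : eqd (c1 :: p) w by move=> d; rewrite (cnt_perm _ _ pp).
have cC x : cross (~: Z) x = cross Z x by rewrite /cross !in_setC; do 2!case: (_ \in _).
have cp : count (cross Z) p = 3.
  by move: c4; rewrite -(eqd_count rK (cross_rv fsrc rK Z) ep) /= {1}/cross (negbTE sc1) tc1 => -[].
have [P [c2 [p2 [Ep [wP wp2] PZ tc2 cp2]]]] := walk_exit wp tc1 cp.
have tc2' : tgt c2 \in ~: Z by rewrite in_setC.
have cp2' : count (cross (~: Z)) p2 = 2 by rewrite (eq_count cC).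
have [O1 [c3 [p3 [Ep2 [wO1 wp3] O1Z tc3 cp3]]]] := walk_exit wp2 tc2' cp2'.
have tc3' : tgt c3 \in Z by move: tc3; rewrite in_setC negbK.
rewrite (eq_count cC) in cp3.
have [Q [d4 [O2 [Ep3 [wQ wO2] QZ td4 cO2]]]] := walk_exit wp3 tc3' cp3.
rewrite Ep Ep2 Ep3 in ep pp; have es := eqd_sym ep.
have balP a R b : walk a R b -> {in verts a R, forall y, y \in Z} ->
    {subset R <= c1 :: P ++ c2 :: O1 ++ c3 :: Q ++ d4 :: O2} -> balanced R.
  move=> wR RZ sR; apply/eqP; rewrite -leqn0 leqNgt -has_count; apply/hasPn => d dR.
  have [sd td] := dart_verts wR dR.
  by apply: bal; [rewrite (perm_mem pp) sR|exact: RZ|exact: RZ].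
apply: three_odd_eqd ep _; apply: four_cut_passages.
- by rewrite -(eqd_size rK es).
- exact: val_lt3_eqd es sw.
- exact: conserved_eqd es cw.
- by rewrite -(pr_eqd rK rpar es).
- by move=> A; rewrite -(eqd_count rK (cross_rv fsrc rK A) es).
- split=> //; apply: balP wP PZ _ => d dP.
  by rewrite in_cons mem_cat dP orbT.
- by split=> // y /O1Z; rewrite in_setC.
- split=> //; apply: balP wQ QZ _ => d dQ.
  by rewrite !(in_cons, mem_cat) dQ !orbT.
by split=> // y yO; rewrite (walk_cross0 wO2 cO2 yO).
Qed.

End FourCut.

End Reductions.

Theorem three_odd_of_flow (V : finType) (v : V) (w : seq (fdart V)) :
  walk (@fsrc V) (@frv V) v w v -> val_lt3 w -> conserved w -> pr (@fpar V) w -> three_odd w.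
Proof.
have [n] := ubnP (size w); elim: n v w => // n IH v w sz wv sw cw ow.
have [[Z c2]|no2] := pselect (exists Z : {set V}, count (cross (@fsrc V) (@frv V) Z) w = 2).
  exact: (two_cut_three_odd IH _ wv sw cw ow c2).
have no2' (Z : {set V}) : count (cross (@fsrc V) (@frv V) Z) w != 2.
  by apply/eqP => c2; apply: no2; exists Z.
have [[Z [s [c4 bal]]]|nb] := pselect (exists (Z : {set V}) s,
    count (cross (@fsrc V) (@frv V) Z) w = 4 /\
    forall d, d \in w -> fsrc d \in Z -> tgt (@fsrc V) (@frv V) d \in Z ->
      ~~ switch (@fsrc V) (@frv V) (@fpar V) s d).
  exact: (four_cut_three_odd IH _ wv sw cw ow no2' c4 bal).
apply: (three_odd_closed_walks (@frvK V) (@fpar_rv V) wv ow no2') => [Z s c4|s].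
  apply: contrapT => h; apply: nb; exists Z, s; split=> // d dw sd td; apply/negP => od.
  by apply: h; exists d.
exact: not_one_odd.
Qed.

(** * Euler tours and flows of signed graphs *)

Section Euler.
Variable G : sgraph.
Notation dart := (edge G * bool)%type.
Definition gsrc (h : dart) : vertex G := hend h.1 h.2.
Definition grv (h : dart) : dart := (h.1, ~~ h.2).

Lemma grvK : involutive grv.
Proof. by case=> e b; rewrite /grv /= negbK. Qed.

Notation gtgt := (tgt gsrc grv).
Notation walk := (walk gsrc grv).
Notation verts := (verts gsrc grv).

Definition deg (E : {set edge G}) u :=
  \sum_(e in E) ((hend e false == u) + (hend e true == u)).

Lemma valencyE (K : subgraph G) u : valency K u = deg (sedges K) u.
Proof.
rewrite /valency /deg cardsE -sum1_card big_mkcond /= (eq_bigr (fun h : dart =>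
  if (h.1 \in sedges K) && (hend h.1 h.2 == u) then 1 else 0)) //.
rewrite -(pair_bigA _ (fun e b => if (e \in sedges K) && (hend e b == u) then 1 else 0)) /=.
rewrite [RHS]big_mkcond; apply: eq_bigr => e _; rewrite big_bool /=.
by case: (e \in _) => //=; rewrite addnC; case: (_ == u); case: (_ == u).
Qed.

Lemma deg_list (p : seq dart) u : uniq (map fst p) ->
  deg [set e in map fst p] u = \sum_(h <- p) ((gsrc h == u) + (gtgt h == u)).
Proof.
move=> up; rewrite /deg (eq_bigl (mem (map fst p))) => [|e]; last by rewrite in_set.
rewrite -big_uniq //= big_map; apply: eq_bigr => -[e b] _.
by rewrite /tgt /gsrc /grv /=; case: b => //=; rewrite addnC.
Qed.

Lemma odd_deg_list (p : seq dart) a b u : uniq (map fst p) -> walk a p b ->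
  odd (deg [set e in map fst p] u) = (a == u) (+) (b == u).
Proof.
move=> up; rewrite deg_list //; elim: p a {up} => [|h p IH] a /=.
  by move/eqP->; rewrite big_nil addbb.
case/andP=> /eqP<- /IH; rewrite big_cons !oddD => ->; rewrite !oddb.
by case: (_ == u); case: (_ == u); case: (_ == u).
Qed.

Lemma deg_sub (E E' : {set edge G}) u : E' \subset E -> deg E u = deg E' u + deg (E :\: E') u.
Proof. by move=> sE; rewrite /deg (big_setID E') /= (setIidPr sE). Qed.

Lemma deg_gt0 (E : {set edge G}) u : 0 < deg E u -> exists h : dart, h.1 \in E /\ gsrc h = u.
Proof.
rewrite lt0n => d0; apply: contrapT => n; case/eqP: d0; rewrite /deg big1 // => e eE.
have nb b : (hend e b == u) = false.
  by apply/eqP => E0; apply: n; exists (e, b).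
by rewrite !nb.
Qed.

Lemma size_trail (p : seq dart) : uniq (map fst p) -> size p <= #|edge G|.
Proof. by move=> up; rewrite -(size_map fst) -(card_uniqP up) max_card. Qed.

Lemma close_trail (F : {set edge G}) p a b : (forall u, ~~ odd (deg F u)) ->
  walk a p b -> uniq (map fst p) -> {subset map fst p <= F} ->
  exists q, [/\ walk a (p ++ q) a, uniq (map fst (p ++ q)) & {subset map fst (p ++ q) <= F}].
Proof.
move=> evF; have [n] := ubnP (#|edge G| - size p); elim: n p b => // n IH p b sn wp up pF.
have [ab|nab] := eqVneq a b; first by subst b; exists [::]; rewrite cats0.
have sF : [set e in map fst p] \subset F by apply/subsetP => e; rewrite in_set; apply: pF.
have [|h [hF hb]] := @deg_gt0 (F :\: [set e in map fst p]) b.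
  have := evF b; rewrite (deg_sub b sF) oddD (odd_deg_list b up wp) eqxx (negbTE nab).
  by case: (deg _ b).
move: hF; rewrite in_setD in_set => /andP[hp hF].
have up' : uniq (map fst (p ++ [:: h])).
  by rewrite map_cat cat_uniq up /= orbF andbT; exact: hp.
have [|||e|q [h1 h2 h3]] := IH (p ++ [:: h]) (gtgt h);
  last by exists ([:: h] ++ q); rewrite -catA in h1 h2 h3.
- have := size_trail up'; move: sn; rewrite size_cat /=; clear; lia.
- by apply: walk_cat wp _; rewrite /= hb !eqxx.
- by [].
by rewrite map_cat mem_cat => /orP[/pF//|]; rewrite inE => /eqP->.
Qed.

(** Hierholzer's argument: by connectivity a closed trail that misses an edge misses one at a
    visited vertex. The missed edges have even degree everywhere, so a closed trail through that
    edge can be spliced in. *)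
Lemma euler_tour (K : subgraph G) v : eulerian K -> v \in sverts K ->
  exists w, [/\ walk v w v, uniq (map fst w) & forall e, (e \in map fst w) = (e \in sedges K)].
Proof.
move=> [[_ conn] evK] vK.
suff ext n w : #|edge G| - size w < n -> walk v w v -> uniq (map fst w) ->
    {subset map fst w <= sedges K} ->
    exists w, [/\ walk v w v, uniq (map fst w) & forall e, (e \in map fst w) = (e \in sedges K)].
  by apply: (ext _ [::]) => //=; apply: ltnSn.
elim: n w => // n IH w sn ww uw wK.
have [full|] := boolP (sedges K \subset map fst w).
  exists w; split=> // e; apply/idP/idP; first exact: wK.
  by move=> eK; apply: (subsetP full).
case/subsetPn=> e0 e0K e0w.
have [h [hK hw hv]] : exists h : dart, [/\ h.1 \in sedges K, h.1 \notin map fst w &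
    gsrc h \in verts v w].
  apply: contrapT => none.
  have step x y : x \in verts v w -> adj K x y -> y \in verts v w.
    move=> xw /exists_inP[e eK /existsP[b /andP[/eqP ex /eqP ey]]].
    have [ew|ew] := boolP (e \in map fst w); last first.
      by case: none; exists (e, b); split=> //; rewrite /gsrc ex.
    case/mapP: ew => -[e' b'] hw /= ee; subst e'.
    move: (dart_verts ww hw) => {hw}[]; rewrite /tgt /gsrc /grv /= -ey.
    by case: b {ex ey}; case: b'.
  have /connectP[p pp ep] : connect (adj K) v (hend e0 false).
    by apply: conn => //; apply: sendsP.
  case: none; exists (e0, false); split=> //; rewrite /gsrc /= ep.
  have reach x : path (adj K) x p -> x \in verts v w -> last x p \in verts v w.
    by elim: (p) x => //= y q IHq x /andP[xy /IHq h] xw; apply/h/(step x).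
  by apply: reach pp _; rewrite mem_head.
have evF u : ~~ odd (deg (sedges K :\: [set e in map fst w]) u).
  have sF : [set e in map fst w] \subset sedges K.
    by apply/subsetP => e; rewrite in_set; apply: wK.
  have ev : ~~ odd (deg (sedges K) u).
    rewrite -valencyE; have [uK|uK] := boolP (u \in sverts K); first exact: evK.
    rewrite /valency (_ : [set _ | _] = set0) ?cards0 //; apply/setP => -[e b]; rewrite !inE /=.
    by apply/andP => -[eK /eqP E]; case/negP: uK; rewrite -E; apply: sendsP.
  by move: ev; rewrite (deg_sub u sF) oddD (odd_deg_list u uw ww) addbb.
have [|||q [wq uq qF]] := @close_trail _ [:: h] (gsrc h) (gtgt h) evF.
- by rewrite /= !eqxx.
- by [].
- by move=> e; rewrite inE => /eqP->; rewrite in_setD in_set hw hK.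
have [w1 [w2 [Ew v1 v2]]] := vertsP ww hv.
have qn e : e \in map fst ([:: h] ++ q) -> (e \notin map fst w) && (e \in sedges K).
  by move/qF; rewrite in_setD in_set.
have pw : perm_eq (w1 ++ ([:: h] ++ q) ++ w2) (([:: h] ++ q) ++ w).
  by rewrite Ew perm_catCA.
have uw' : uniq (map fst (w1 ++ ([:: h] ++ q) ++ w2)).
  rewrite (perm_uniq (perm_map fst pw)) map_cat cat_uniq uq uw andbT.
  by apply/hasPn => e ew; apply/negP => /qn/andP[/negP].
apply: (IH (w1 ++ ([:: h] ++ q) ++ w2)) => //.
- have := size_trail uw'; move: sn; rewrite (perm_size pw) [size (_ ++ w)]size_cat /=; clear; lia.
- by apply: walk_cat v1 (walk_cat wq v2).
move=> e; rewrite (perm_mem (perm_map fst pw)) map_cat mem_cat => /orP[/qn/andP[]//|].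
exact: wK.
Qed.

End Euler.

(** * Flow labels along tours, and subgraphs formed by trails *)

Section FlowsOfGraph.
Variable G : sgraph.
Notation dart := (edge G * bool)%type.
Notation gsrc := (@gsrc G).
Notation grv := (@grv G).
Notation gtgt := (tgt gsrc grv).
Notation fwalk := (walk (@fsrc (vertex G)) (@frv (vertex G))).
Notation walk := (walk gsrc grv).
Notation verts := (verts gsrc grv).

Definition label (phi : dart -> int) (h : dart) : fdart (vertex G) :=
  (gsrc h, gtgt h, negative h.1, phi h).

Definition coherent (phi : dart -> int) := forall h,
  phi (grv h) = if negative h.1 then phi h else (- phi h)%R.

Lemma frv_label phi h : coherent phi -> frv (label phi h) = label phi (grv h).
Proof. by move=> /(_ h) E; rewrite /frv /label /= E /tgt grvK. Qed.

Lemma walk_label phi p a b : fwalk a (map (label phi) p) b = walk a p b.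
Proof. by elim: p a => //= h p IH a; rewrite IH. Qed.

Lemma pr_label phi p : pr (@fpar _) (map (label phi) p) = odd (count (fun h => negative h.1) p).
Proof. by rewrite /pr count_map. Qed.

Lemma wnet_label phi g p : coherent phi -> wnet g (map (label phi) p) =
  (\sum_(e <- map fst p) \sum_(b : bool) g (hend e b) * phi (e, b))%R.
Proof.
move=> co; rewrite /wnet !big_map; apply: eq_bigr => h _.
rewrite frv_label // big_bool /=; case: h => e b /=.
by rewrite /fsrc /ftgt /fval /label /tgt /gsrc /grv /=; case: b => //=; rewrite addrC.
Qed.

Definition net (phi : dart -> int) v := (\sum_(h : dart | hend h.1 h.2 == v) phi h)%R.

Lemma wnet_full phi g p : coherent phi -> perm_eq (map fst p) (enum (edge G)) ->
  wnet g (map (label phi) p) = (\sum_v g v * net phi v)%R.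
Proof.
move=> co pp; rewrite wnet_label // (perm_big _ pp) /= big_enum /=.
rewrite (pair_bigA _ (fun e b => g (hend e b) * phi (e, b))%R) /=.
rewrite (partition_big (fun h : dart => hend h.1 h.2) xpredT) //=.
apply: eq_bigr => v _; rewrite /net mulr_sumr; apply: eq_bigr => -[e b] /=.
by move/eqP->.
Qed.

Lemma flow_netE (o : edge G -> bool -> bool) (xi : edge G -> int) v :
  (\sum_(h : dart | (hend h.1 h.2 == v) && o h.1 h.2) xi h.1
   - \sum_(h : dart | (hend h.1 h.2 == v) && ~~ o h.1 h.2) xi h.1 =
  net (fun h => if o h.1 h.2 then xi h.1 else - xi h.1) v)%R.
Proof.
rewrite /net [RHS](bigID (fun h : dart => o h.1 h.2)) /= -sumrN; congr (_ + _)%R.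
  by apply: eq_bigr => h /andP[_ ->].
by apply: eq_bigr => h /andP[_ /negbTE->].
Qed.

Lemma orientation_coherent (o : edge G -> bool -> bool) xi : orientation o ->
  coherent (fun h => if o h.1 h.2 then xi h.1 else - xi h.1)%R.
Proof.
move=> oo [e b] /=; move: (oo e).
by case: (negative e); case: b => /= ->; case: (o _ _); rewrite ?opprK.
Qed.

Lemma flow_of_tour (p : seq dart) (val : edge G -> int) k :
  perm_eq (map fst p) (enum (edge G)) -> (forall e, 0 < `|val e| < k)%N ->
  conserved (map (label (fun h => val h.1)) p) -> has_nowhere_zero_flow G k.
Proof.
move=> pp kv cp; pose dir e := (e, true) \in p.
(* [(e, dir e)] is the half-edge where the tour starts along [e]. It points away from its end, as do
   both halves of a negative edge, so [val] is what leaves the source of each tour dart. *)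
pose o e b := (b == dir e) || negative e.
have up : uniq (map fst p) by rewrite (perm_uniq pp) enum_uniq.
have dirE h : h \in p -> dir h.1 = h.2.
  case: h => e b hp; rewrite /dir /=; case: b hp => // hp; apply/negbTE/negP => tp.
  have uf := map_uniq up.
  have := nth_index (e, true) tp; have := nth_index (e, true) hp.
  set i := index _ p; set j := index _ p => Ei Ej.
  have li : i < size p by rewrite index_mem.
  have lj : j < size p by rewrite index_mem.
  have : i == j.
    rewrite -(nth_uniq e _ _ up) ?size_map // !(nth_map (e, true)) // Ei Ej //=.
  by move/eqP=> ij; move: Ei; rewrite ij Ej.
exists o, val; split=> //.
  move=> e; rewrite /o; case: (negative e); rewrite ?orbT // !orbF.
  by case: (dir e).
pose phi := fun h : dart => (if o h.1 h.2 then val h.1 else - val h.1)%R.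
have co : coherent phi.
  apply: orientation_coherent => e; rewrite /o; case: (negative e); rewrite ?orbT // !orbF.
  by case: (dir e).
move=> v; rewrite flow_netE -/phi.
have E : map (label phi) p = map (label (fun h => val h.1)) p.
  by apply/eq_in_map => h hp; rewrite /label /phi /o dirE // eqxx.
have := cp (fun u => (u == v)%:R)%R; rewrite -E wnet_full // (bigD1 v) //= eqxx mul1r.
rewrite big1 ?addr0 // => u /negbTE->; exact: mul0r.
Qed.

(** The amount carried along the trail is negated by each negative edge; inner vertices cancel and
    only the two ends remain. No edge repeats, so the values can be assigned edge by edge. *)
Lemma alternating_values (p : seq dart) a b eps : walk a p b -> uniq (map fst p) ->
  exists2 val : edge G -> int, forall e, `|val e|%N = `|eps|%N &
    forall g, wnet g (map (label (fun h => val h.1)) p) =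
      (g a * eps - g b * (if odd (count (fun h => negative h.1) p) then - eps else eps))%R.
Proof.
elim: p a eps => [|h p IH] a eps /=.
  by move/eqP-> => _; exists (fun=> eps) => // g; rewrite wnet_nil subrr.
case/andP=> /eqP sh w /andP[hp up].
have [val vE vnet] := IH _ (if negative h.1 then - eps else eps)%R w up.
exists (fun e => if e == h.1 then eps else val e) => [e|g].
  by case: eqP => // _; rewrite vE; case: (negative _); rewrite ?abszN.
rewrite wnet_cons (_ : map _ p = map (label (fun h => val h.1)) p); last first.
  apply/eq_in_map => k kp; rewrite /label; case: eqP => // E.
  by case/negP: hp; rewrite -E map_f.
rewrite vnet /fsrc /ftgt /fval /frv /label /= eqxx sh oddD.
move: (g a) (g (gtgt h)) (g b) => x y z; clear.
by case: (negative h.1); case: (odd _) => /=; rewrite ?opprK; lia.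
Qed.


(** Parallel edges may have the same label, so the darts of [T] are matched one at a time with edges
    of [w] that are then removed. *)
Lemma lift_labels phi T (w : seq dart) : coherent phi ->
  eqd (@frv (vertex G)) T (map (label phi) w) ->
  exists2 L, map (label phi) L = T & perm_eq (map fst L) (map fst w).
Proof.
move=> co; elim: T w => [|d T IH] w E.
  have := eqd_size (@frvK _) E; case: w E => //= _ _; by exists [::].
have [h [h' [hw hh' dh']]] : exists h h', [/\ h \in w, h'.1 = h.1 & label phi h' = d /\
    (h' = h \/ h' = grv h)].
  have /orP[/mapP[h hw ->]|/mapP[h hw e]] := eqd_mem E (mem_head d T).
    by exists h, h; split=> //; split=> //; left.
  exists h, (grv h); split=> //; split; last by right.
  by rewrite -frv_label // -e frvK.
have E' : eqd (@frv _) T (map (label phi) (rem h w)).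
  move=> x; have := E x; rewrite cnt_cons (cnt_perm _ _ (perm_map _ (perm_to_rem hw))) /=.
  rewrite [RHS]cnt_cons; case: dh' => <- [->|->]; first by move/addnI.
  by rewrite -frv_label // (cnt_rv (@frvK _)) => /addnI.
have [L EL pL] := IH _ E'; exists (h' :: L); first by rewrite /= EL; case: dh' => ->.
by rewrite (permPr (perm_map fst (perm_to_rem hw))) /= hh' perm_cons.
Qed.

Lemma walk_connect (K : subgraph G) a p b : walk a p b -> {subset map fst p <= sedges K} ->
  connect (adj K) a b.
Proof.
elim: p a => [a /eqP->|h p IH a /= /andP[/eqP<- w] sK]; first by move=> _; apply: connect0.
apply: connect_trans (IH _ w _); last by move=> e ep; apply: sK; rewrite inE ep orbT.
apply/connect1/exists_inP; exists h.1; first by apply: sK; rewrite mem_head.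
by apply/existsP; exists h.2; rewrite /gsrc /tgt /grv /= !eqxx.
Qed.

Lemma trail_ends p a b : walk a p b -> forall (e : edge G) c,
  e \in [set e in map fst p] -> hend e c \in [set u in verts a p].
Proof.
move=> w e c; rewrite !in_set => /mapP[[e' b'] hp /= ->].
move: (dart_verts w hp) => {hp}[]; rewrite /tgt /gsrc /grv /=.
by case: b'; case: c.
Qed.

Definition trail_subgraph p a b (w : walk a p b) : subgraph G :=
  Subgraph (trail_ends w).

Lemma trail_eulerian p a (w : walk a p a) : uniq (map fst p) -> eulerian (trail_subgraph w).
Proof.
move=> up; split; last first.
  by move=> u _; rewrite valencyE /= (odd_deg_list u up w) addbb.
have sub q : {subset q <= p} -> {subset map fst q <= sedges (trail_subgraph w)}.
  by move=> sq e /mapP[h /sq hp ->]; rewrite in_set map_f.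
have toa u : u \in sverts (trail_subgraph w) ->
    connect (adj (trail_subgraph w)) a u /\ connect (adj (trail_subgraph w)) u a.
  rewrite in_set => /(vertsP w)[p1 [p2 [E w1 w2]]].
  split; [apply: walk_connect w1 _|apply: walk_connect w2 _]; apply: sub => h hp;
    by rewrite E mem_cat hp ?orbT.
split; first by apply/set0Pn; exists a; rewrite in_set mem_head.
by move=> x y /toa[_ xa] /toa[ay _]; apply: connect_trans xa ay.
Qed.

Lemma num_negative_list (K : subgraph G) (p : seq dart) : uniq (map fst p) ->
  (forall e, (e \in map fst p) = (e \in sedges K)) ->
  num_negative K = count (fun h => negative h.1) p.
Proof.
move=> up mp; rewrite /num_negative.
rewrite (_ : [set _ in _ | _] = [set e in filter (@negative G) (map fst p)]).
  by rewrite cardsE (card_uniqP (filter_uniq _ up)) size_filter count_map.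
by apply/setP => e; rewrite !in_set mem_filter mp andbC.
Qed.

Lemma full_tour : eulerian (whole G) -> exists v w, [/\ walk v w v,
  uniq (map fst w) & perm_eq (map fst w) (enum (edge G))].
Proof.
move=> eG; have [[/set0Pn[v vG] _] _] := eG.
have [w [ww uw mw]] := euler_tour eG vG.
exists v, w; split=> //; apply: uniq_perm => //; first exact: enum_uniq.
by move=> e; rewrite mw mem_enum !inE.
Qed.

Lemma two_flow_of_even v w : walk v w v -> uniq (map fst w) ->
  perm_eq (map fst w) (enum (edge G)) -> ~~ odd (count (fun h : dart => negative h.1) w) ->
  has_nowhere_zero_flow G 2.
Proof.
move=> ww uw pw ev; have [val vE vnet] := alternating_values 1%R ww uw.
apply: (flow_of_tour (val := val) pw) => [e|g]; first by rewrite vE.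
by rewrite vnet (negbTE ev) subrr.
Qed.

(** If all values are 1 or -1, the total outflow is a sum of terms 2 or -2, one per negative edge.
    It is congruent to twice their number modulo 4, hence not 0 when that number is odd. *)
Lemma no_small_flow (p : seq dart) k : perm_eq (map fst p) (enum (edge G)) ->
  odd (count (fun h => negative h.1) p) -> has_nowhere_zero_flow G k -> 3 <= k.
Proof.
move=> pp op [o [xi [oo fl bd]]]; rewrite leqNgt; apply/negP => k3.
have xi1 e : `|xi e| = 1%N by have := bd e; move: k3; clear; lia.
pose phi := fun h : dart => (if o h.1 h.2 then xi h.1 else - xi h.1)%R.
have co : coherent phi by apply: orientation_coherent.
have phi1 h : `|phi h|%N = 1%N by rewrite /phi; case: (o _ _); rewrite ?abszN xi1.
have w0 : wnet (fun=> 1%R) (map (label phi) p) = 0%R.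
  by rewrite wnet_full // big1 // => v _; rewrite -flow_netE fl mulr0.
have [m Em] : exists m : int, (wnet (fun=> 1) (map (label phi) p) =
    (count (fun h => negative h.1) p)%:Z *+ 2 + m *+ 4)%R.
  elim: (p) => [|h q [m IH]] /=; first by exists 0%R; rewrite wnet_nil.
  rewrite wnet_cons IH frv_label // !mul1r /fval /label /= co.
  have := phi1 h; case: (negative h.1) => /= ph; last by exists m; lia.
  have [->|->] : (phi h = 1 \/ phi h = -1)%R by clear -ph; lia.
    by exists m; lia.
  by exists (m - 1)%R; lia.
by move: Em op; rewrite w0; move: (count _ _) => c; clear; lia.
Qed.

End FlowsOfGraph.

Theorem theorem14 (G : sgraph)
    (G_connected : connected (whole G)) (G_eulerian : eulerian (whole G)) :
  flow_number G 3 <->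
  exists H : 'I_3 -> subgraph G,
    [/\ decomposition H,
        forall i, eulerian (H i) /\ odd (num_negative (H i))
      & exists v : vertex G, forall i, v \in sverts (H i)].
Proof.
have [v0 [w [ww uw pw]]] := full_tour G_eulerian.
split=> [[[o [xi [oo fl bd]]] min3]|[H [[disj covE covV] eH [v vH]]]].
  pose phi := fun h : edge G * bool => (if o h.1 h.2 then xi h.1 else - xi h.1)%R.
  have co : coherent phi by apply: orientation_coherent.
  have sw : val_lt3 (map (label phi) w).
    apply/allP => d /mapP[h _ ->]; rewrite /fval /label /phi /=.
    by case: (o _ _); rewrite ?abszN bd.
  have cw : conserved (map (label phi) w).
    by move=> g; rewrite wnet_full // big1 // => v _; rewrite -flow_netE fl mulr0.
  (* An even tour would give a nowhere-zero 2-flow, against the minimality of 3. *)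
  have ow : pr (@fpar _) (map (label phi) w).
    rewrite pr_label; apply: contraT => ev.
    by have := min3 _ (two_flow_of_even ww uw pw ev).
  have fw : walk (@fsrc _) (@frv _) v0 (map (label phi) w) v0 by rewrite walk_label.
  have [v [T1 [T2 [T3 [w1 w2 w3 E [o1 o2 o3]]]]]] := three_odd_of_flow fw sw cw ow.
  have [L EL pL] := lift_labels co E.
  have [L1 [L2 [L3 [e0 e1 e2 e3]]]] : exists L1 L2 L3, [/\ L = L1 ++ L2 ++ L3,
      map (label phi) L1 = T1, map (label phi) L2 = T2 & map (label phi) L3 = T3].
    exists (take (size T1) L), (take (size T2) (drop (size T1) L)), (drop (size T2) (drop (size T1) L)).
    rewrite !cat_take_drop !(map_take, map_drop) EL take_size_cat // drop_size_cat //.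
    by rewrite take_size_cat // drop_size_cat.
  subst T1 T2 T3; rewrite !walk_label in w1 w2 w3; rewrite !pr_label in o1 o2 o3.
  have uL : uniq (map fst L) by rewrite (perm_uniq pL).
  have allL e : e \in map fst L by rewrite (perm_mem pL) (perm_mem pw) mem_enum.
  rewrite e0 !map_cat in uL allL.
  pose Ls (i : 'I_3) := nth [::] [:: L1; L2; L3] i.
  have wL i : walk (@gsrc G) (@grv G) v (Ls i) v by case: i => [[|[|[|]]]].
  move: uL; rewrite !cat_uniq => /and5P[u1 n1 u2 n2 u3].
  have uLs i : uniq (map fst (Ls i)) by case: i => [[|[|[|]]]].
  have cover e : exists i, e \in map fst (Ls i).
    have := allL e; rewrite !mem_cat => /or3P[] h.
    - by exists ord0.
    - by exists (@Ordinal 3 1 isT).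
    by exists (@Ordinal 3 2 isT).
  have [_ conn] := G_connected.
  exists (fun i => trail_subgraph (wL i)); split.
  - split=> /=.
    + move=> i j ij; apply/pred0P => e /=; rewrite !in_set.
      have no12 x : x \in map fst L1 -> x \in map fst L2 -> False.
        by move=> x1 x2; case/hasP: n1; exists x; rewrite // mem_cat x2.
      have no13 x : x \in map fst L1 -> x \in map fst L3 -> False.
        by move=> x1 x3; case/hasP: n1; exists x; rewrite // mem_cat x3 orbT.
      have no23 x : x \in map fst L2 -> x \in map fst L3 -> False.
        by move=> x2 x3; case/hasP: n2; exists x.
      apply/negbTE/negP => /andP[]; case: i j ij => [[|[|[|]]]] // ? [[|[|[|]]]] //= ? _; rewrite /Ls /=;
        by [move=> /no12 h /h|move=> /no13 h /h|move=> h /no12/(_ h)|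
            move=> /no23 h /h|move=> h /no13/(_ h)|move=> h /no23/(_ h)].
    + apply/setP => e; rewrite in_setT; apply/bigcupP.
      by have [i ei] := cover e; exists i; rewrite // in_set.
    apply/setP => u; rewrite in_setT; apply/bigcupP.
    have [->|nuv] := eqVneq u v; first by exists ord0; rewrite // in_set mem_head.
    (* The last edge of a path from [v] to [u] lies on one of the three trails, which therefore
       visits [u]. *)
    have /connectP[p] : connect (adj (whole G)) v u by apply: conn; rewrite in_setT.
    case: (lastP p) => [_ /= uv|q y]; first by rewrite uv eqxx in nuv.
    rewrite rcons_path last_rcons => /andP[_ /exists_inP[e _ /existsP[b /andP[_ /eqP eu]]]] ->.
    have [i ei] := cover e; exists i => //.
    by rewrite -eu; apply: (@sendsP _ (trail_subgraph (wL i))); rewrite in_set.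
  - move=> i; split; first exact: trail_eulerian.
    rewrite (num_negative_list (uLs i)) => [|e]; last by rewrite in_set.
    by case: i => [[|[|[|]]]].
  by exists v => i; rewrite in_set mem_head.
have tour i : exists p, [/\ walk (@gsrc G) (@grv G) v p v, uniq (map fst p) &
    forall e, (e \in map fst p) = (e \in sedges (H i))].
  by have [ei _] := eH i; apply: euler_tour ei (vH i).
pose i1 : 'I_3 := @Ordinal 3 1 isT; pose i2 : 'I_3 := @Ordinal 3 2 isT.
have [p0 [w0 u0 m0]] := tour ord0; have [p1 [w1 u1 m1]] := tour i1.
have [p2 [w2 u2 m2]] := tour i2.
have o0 := (eH ord0).2; have o1 := (eH i1).2; have o2 := (eH i2).2.
rewrite (num_negative_list u0 m0) in o0; rewrite (num_negative_list u1 m1) in o1.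
rewrite (num_negative_list u2 m2) in o2.
have no i j : i != j -> forall e, e \in sedges (H i) -> (e \in sedges (H j)) = false.
  by move=> /disj d e; apply: disjointFr.
have pp : perm_eq (map fst (p0 ++ p1 ++ p2)) (enum (edge G)).
  apply: uniq_perm => [||e]; [|exact: enum_uniq|].
    rewrite !map_cat !cat_uniq u0 u1 u2 /= andbT; apply/andP; split; apply/hasPn => e /=.
      rewrite mem_cat m0 m1 m2; apply: contraTN => e0.
      by rewrite !(no ord0 _ _ _ e0).
    by rewrite m1 m2; apply: contraTN => e1; rewrite (no i1 _ _ _ e1).
  rewrite mem_enum !map_cat !mem_cat m0 m1 m2 inE.
  have : e \in \bigcup_(i < 3) sedges (H i) by rewrite covE in_setT.
  case/bigcupP=> i _ he; apply/or3P.
  have [E|[E|E]] : i = ord0 \/ i = i1 \/ i = i2.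
  - by case: i {he} => [[|[|[|]]]] // li; [left|right; left|right; right]; apply: val_inj.
  - by apply: Or31; rewrite -E.
  - by apply: Or32; rewrite -E.
  by apply: Or33; rewrite -E.
have op : odd (count (fun h : edge G * bool => negative h.1) (p0 ++ p1 ++ p2)).
  by rewrite !count_cat !oddD o0 o1 o2.
split; last by move=> j; apply: no_small_flow pp op.
have [val0 V0 n0] := alternating_values 1%R w0 u0.
have [val1 V1 n1] := alternating_values 1%R w1 u1.
have [val2 V2 n2] := alternating_values (-2)%R w2 u2.
pose val e := if e \in map fst p0 then val0 e else if e \in map fst p1 then val1 e else val2 e.
apply: (flow_of_tour (val := val) pp) => [e|g].
  by rewrite /val; case: ifP => _; [rewrite V0|case: ifP => _; rewrite ?V1 ?V2].
rewrite !map_cat !wnet_cat.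
have E (q : seq (edge G * bool)) f : {in map fst q, val =1 f} ->
    map (label (fun h => val h.1)) q = map (label (fun h => f h.1)) q.
  by move=> h; apply/eq_in_map => k kq; rewrite /label h // map_f.
rewrite (E p0 val0) => [|e e0]; last by rewrite /val e0.
rewrite (E p1 val1) => [|e e1]; last first.
  by have e1' := e1; rewrite m1 in e1'; rewrite /val e1 m0 (no i1 ord0 isT e e1').
rewrite (E p2 val2) => [|e e2]; last first.
  by have e2' := e2; rewrite m2 in e2'; rewrite /val m0 m1 (no i2 ord0 isT e e2') (no i2 i1 isT e e2').
rewrite n0 n1 n2 o0 o1 o2; move: (g v) => x; clear; lia.
Qed.
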